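(* Assume that $F$ is an odd function. Then for every $x\in\mathbb{R}$ the limit $$U_\infty(x):=\lim_{t\to\infty}u(t,x)$$ exists. Moreover, $U=U_\infty|_{(0,\infty)}$ (extended by $U(0)=0$) is the maximal solution of the nonlocal elliptic problem $$0=\tfrac12\Delta U(x)+\zeta\bigl[F(U(\gamma^{-1}x))-U(x)\bigr],\quad x>0;\qquad U(0)=0;\qquad U(x)\le 1,\quad x>0,$$ that is, it is a solution, and every solution $V$ of this problem satisfies $V(x)\le U(x)$ for all $x>0$.
   Context: Fix $\gamma>1$ and $\zeta>0$, offspring probabilities $p_n\ge 0$ ($n\ge1$) with $\sum_{n\ge1}p_n=1$, and threshold probabilities $\eta_{n,k}\ge0$ ($n\ge1$, $1\le k\le n$) with $\sum_{k=1}^n\eta_{n,k}=1$ for each $n$. Define $F:[-1,1]\to[-1,1]$ by $$F(u)=\sum_{n\ge1}2^{1-n}p_n\sum_{k=1}^n\eta_{n,k}\sum_{j=k}^n\binom nj(1+u)^j(1-u)^{n-j}-1 ,$$ so $F(\pm1)=\pm1$. The function $F$ is increasing and is taken to be $C^2$ on $[0,1]$. The function $u:[0,\infty)\times\mathbb{R}\to[-1,1]$ is the solution (in the Duhamel/mild sense) of $$\partial_tu(t,x)=\tfrac12\Delta u(t,x)+\zeta\bigl[F(u(t,\gamma^{-1}x))-u(t,x)\bigr]\ (t>0,\ x\in\mathbb{R}),\qquad u(0,x)=\operatorname{sgn}(x),$$ i.e. $u(t,\cdot)=e^{t(\frac12\Delta-\zeta)}\operatorname{sgn}+\zeta\int_0^te^{(t-s)(\frac12\Delta-\zeta)}\bigl[F(u(s,\gamma^{-1}\cdot))\bigr]\,ds$.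 (Probabilistic meaning: start a branching Brownian motion with one generation-$0$ particle at $x$; a generation-$k$ particle moves as a Brownian motion with generator $\frac12\gamma^{2k}\Delta$ and at rate $\zeta$ is replaced by $n$ generation-$(k+1)$ particles with probability $p_n$. At time $t$ each living particle at $y$ votes $\operatorname{sgn}(y)$; a particle with $n$ children samples $L$ with $P(L=k)=\eta_{n,k}$ independently and votes $1$ if at least $L$ of its children vote $1$, and $-1$ otherwise. Then $u(t,x)=2p-1$, where $p$ is the probability that the initial particle votes $1$.) Solutions $U:[0,\infty)\to\mathbb{R}$ of the elliptic problem are continuous on $[0,\infty)$, $C^2$ on $(0,\infty)$, and take values in the domain $[-1,1]$ of $F$. *)

(* Defs.v *)
From HB Require Import structures.
From mathcomp Require Import all_boot all_order all_algebra.
From mathcomp Require Import all_classical all_reals all_analysis.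

Set Implicit Arguments.
Unset Strict Implicit.
Unset Printing Implicit Defensive.

Import Order.TTheory GRing.Theory Num.Theory.
Import numFieldNormedType.Exports.

Local Open Scope classical_set_scope.
Local Open Scope ring_scope.

(* The value of [p] at 0 is irrelevant: every particle has at least one child. *)
Definition offspring_law (R : realType) (p : nat -> R) : Prop :=
  (forall n, (1 <= n)%N -> 0 <= p n) /\
  (\sum_(1 <= n < N) p n @[N --> \oo] --> (1 : R)).

Definition threshold_law (R : realType) (eta : nat -> nat -> R) : Prop :=
  forall n, (1 <= n)%N ->
    (forall k, (1 <= k <= n)%N -> 0 <= eta n k) /\
    \sum_(1 <= k < n.+1) eta n k = 1.

(* [2 ^- n.-1] is 2^(1-n), as n >= 1.  The terms are nonnegative and at most
   [2 * p n] for v in [-1, 1], so the series converges there; the values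
   outside [-1, 1] are meaningless and never used. *)
Definition voteF (R : realType) (p : nat -> R) (eta : nat -> nat -> R)
    (v : R) : R :=
  limn (fun N => \sum_(1 <= n < N) (2 ^- n.-1 * p n *
     \sum_(1 <= k < n.+1) (eta n k *
       \sum_(k <= j < n.+1)
          'C(n, j)%:R * (1 + v) ^+ j * (1 - v) ^+ (n - j)))) - 1.

Definition odd_on_unit (R : realType) (f : R -> R) : Prop :=
  forall v, -1 <= v <= 1 -> f (- v) = - f v.

(* Derivative relative to [A]: one-sided at the endpoints of an interval. *)
Definition derivative_within (R : realType) (A : set R) (f : R -> R)
    (x l : R) : Prop :=
  (f y - f x) / (y - x) @[y --> within A x^'] --> l.

Definition C2_on (R : realType) (A : set R) (f : R -> R) : Prop :=
  exists f1 f2 : R -> R,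
    [/\ forall x, A x -> derivative_within A f x (f1 x),
        forall x, A x -> derivative_within A f1 x (f2 x)
      & {within A, continuous f2}].

(* [normal_pdf x s] takes the standard deviation s, so for t > 0 this is
   e^(-zeta t) times the convolution of [f] with the kernel of e^(t Delta / 2).
   At t = 0 the library's density is not a Dirac mass, hence the case split. *)
Definition killed_heat (R : realType) (zeta t : R) (f : R -> R) (x : R) : R :=
  if t == 0 then f x
  else expR (- (zeta * t)) *
       Rintegral lebesgue_measure setT
         (fun y => normal_pdf x (Num.sqrt t) y * f y).

(* Only the values [u t x] with t >= 0 are constrained. *)
Definition mild_solution (R : realType) (gamma zeta : R) (F : R -> R)
    (u : R -> R -> R) : Prop :=
  [/\ forall t x, 0 <= t -> -1 <= u t x <= 1,
      measurable_fun [set z : R * R | 0 <= z.1] (fun z : R * R => u z.1 z.2)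
    & forall t x, 0 <= t ->
        u t x = killed_heat zeta t Num.sg x +
          zeta * Rintegral lebesgue_measure `[0, t]
            (fun s => killed_heat zeta (t - s)
                        (fun y => F (u s (gamma^-1 * y))) x)].

(* Only the values of [U] on [0, +oo) are constrained. *)
Definition elliptic_solution (R : realType) (gamma zeta : R) (F : R -> R)
    (U : R -> R) : Prop :=
  [/\ {within `[0, +oo[, continuous U},
      forall x, 0 < x ->
        [/\ derivable U x 1, derivable U^`()%classic x 1
          & {for x, continuous U^`(2)%classic}],
      forall x, 0 <= x -> -1 <= U x <= 1,
      U 0 = 0
    & forall x, 0 < x ->
        0 = 2^-1 * U^`(2)%classic x + zeta * (F (U (gamma^-1 * x)) - U x)].

Definition maximal_elliptic_solution (R : realType) (gamma zeta : R)
    (F : R -> R) (U : R -> R) : Prop :=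
  elliptic_solution gamma zeta F U /\
  forall V, elliptic_solution gamma zeta F V -> forall x, 0 < x -> V x <= U x.

(* Main.v *)
Require Import Defs.
From HB Require Import structures.
From mathcomp Require Import all_boot all_order all_algebra.
From mathcomp Require Import all_classical all_reals all_analysis.
From mathcomp Require Import measurable_realfun ring lra.

(* Let T be an exponential time of rate zeta, B an independent Brownian motion
   started at x, and P_t the heat semigroup.  Duhamel's formula reads
     u(t,x) = e^(-zeta t) P_t sgn(x) + E_x[F(u(t - T, B_T / gamma)); T < t].
   On odd functions both terms are monotone on the half-line x > 0, because the
   kernel difference p(x,y) - p(-x,y) has the sign of y; moreover P_t sgn(x)
   decreases in t and dominates what an odd function bounded by 1 contributes
   from the times T >= t.  A Gronwall argument, for which the semigroup property
   is not needed, then gives u(t + h, x) <= u(t, x) and V(x) <= u(t, x) for every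
   elliptic solution V.  The decreasing limit satisfies
   U(x) = E_x[F(U(B_T / gamma))].  As B_T has density (k/2) e^(-k|x - y|) with
   k = sqrt(2 zeta), this is the integrated form of the elliptic equation, and
   the two forms are equivalent because a bounded solution of w'' = k^2 w that
   vanishes at 0 is zero. *)

Set Implicit Arguments.
Unset Strict Implicit.
Unset Printing Implicit Defensive.

Import Order.TTheory GRing.Theory Num.Theory.
Import numFieldNormedType.Exports.

Local Open Scope classical_set_scope.
Local Open Scope ring_scope.

(** * The vote function *)

(** On [[-1, 1]] the function [F] is nondecreasing, odd and, by [F_C2] and oddness, Lipschitz.
    Composed with the projection onto [[-1, 1]] it becomes a total function [G] with these
    properties and [|G| <= 1], and the analysis is carried out for [G]. The obstacle is that the
    desired order holds only for [x > 0] and is reversed for [x < 0], so monotonicity of [F] cannot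
    be applied under an expectation over the whole line. Hence all comparisons are between odd
    functions, and even the Gronwall bound has to be made odd by a factor [sgn(y)]. Oddness of [u]
    itself comes from a separate use of the same Gronwall estimate. For the monotonicity in time,
    [u(t + h)] and [u(t)] are both expanded from time 0. The jump times in [[t, t + h)] contribute
    at most [(e^(-zeta t) - e^(-zeta (t + h))) P_t sgn(x)], no more than what the initial term
    loses, because [sgn] is the largest odd function bounded by 1 on [x > 0]. The bound for elliptic
    solutions is the same argument with the window [[t, +oo)]. *)

Section binomial_tail.
Variable R : realType.

(** This is [2^n] times the probability that a binomial variable with parameters [n] and [a / 2] is
    at least [k]. The vote function uses it at [a = 1 + v], so that [2 - a = 1 - v]. *)
Definition binomial_tail (n k : nat) (a : R) : R :=
  \sum_(k <= j < n.+1) 'C(n, j)%:R * a ^+ j * (2 - a) ^+ (n - j).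

Lemma binomial_tail0 n a : binomial_tail n 0 a = 2 ^+ n.
Proof.
rewrite /binomial_tail big_mkord -[X in X ^+ n](subrK a) addrC exprDn_comm; last exact: mulrC.
by apply: eq_bigr => i _; rewrite -[RHS]mulr_natl mulrA mulrAC.
Qed.

(** Conditioning on the outcome of one trial, that is, Pascal's rule. The recursion makes
    monotonicity in [a] an induction, without differentiating. *)
Lemma binomial_tailS n k a :
  binomial_tail n.+1 k.+1 a = a * binomial_tail n k a + (2 - a) * binomial_tail n k.+1 a.
Proof.
rewrite /binomial_tail.
have [nk|kn] := ltnP n k.
  by rewrite !big_geq ?mulr0 ?addr0// ltnW.
rewrite !big_add1/= !mulr_sumr.
under eq_bigr do rewrite binS natrD 2!mulrDl subSS.
rewrite big_split/= addrC; congr (_ + _).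
  by apply: eq_bigr => j _; rewrite exprS; ring.
rewrite big_nat_recr//= bin_small// !mul0r addr0.
apply: eq_big_nat => j /andP[_ jn].
by rewrite -[(n - j)%N]prednK ?subn_gt0// subnS [(2 - a) ^+ _.+1]exprS; ring.
Qed.

Lemma binomial_tail_ge0 n k a : 0 <= a <= 2 -> 0 <= binomial_tail n k a.
Proof.
move=> /andP[a0 a2]; apply: sumr_ge0 => j _.
by rewrite !mulr_ge0// exprn_ge0// subr_ge0.
Qed.

Lemma binomial_tail_le n k a : 0 <= a <= 2 -> binomial_tail n k.+1 a <= binomial_tail n k a.
Proof.
move=> /andP[a0 a2]; have [nk|kn] := ltnP n k.
  by rewrite /binomial_tail !big_geq// ltnW.
rewrite /binomial_tail [leRHS]big_ltn// lerDr !mulr_ge0// exprn_ge0// subr_ge0//.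
Qed.

Lemma binomial_tail_homo n k a a' : 0 <= a -> a <= a' -> a' <= 2 ->
  binomial_tail n k a <= binomial_tail n k a'.
Proof.
move=> a0 aa' a'2; have a2 := le_trans aa' a'2; have a'0 := le_trans a0 aa'.
elim: n k => [|n IH] [|k].
- by rewrite !binomial_tail0.
- by rewrite /binomial_tail !big_geq.
- by rewrite !binomial_tail0.
- rewrite !binomial_tailS.
  apply: (@le_trans _ _ (a * binomial_tail n k a' + (2 - a) * binomial_tail n k.+1 a')).
    by apply: lerD; rewrite ler_wpM2l// subr_ge0.
  (* Once the tails are evaluated at [a'], only the weights [a] and [2 - a] change; more weight on
     the larger of the two tails increases the sum. *)
  have := @binomial_tail_le n k a' _; rewrite a'0 a'2 => /(_ isT) H.
  rewrite -subr_ge0.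
  rewrite (_ : _ - _ = (a' - a) * (binomial_tail n k a' - binomial_tail n k.+1 a')); last by ring.
  by rewrite mulr_ge0 ?subr_ge0.
Qed.

Lemma binomial_tail2 n k : (k <= n)%N -> binomial_tail n k 2 = 2 ^+ n.
Proof.
move=> kn; rewrite /binomial_tail big_nat_recr//= subrr subnn expr0 mulr1 binn mul1r.
rewrite big_nat big1 ?add0r// => j /andP[_ jn].
by rewrite expr0n subn_eq0 leqNgt jn/= mulr0.
Qed.

End binomial_tail.

Section vote.
Variables (R : realType) (p : nat -> R) (eta : nat -> nat -> R).
Hypotheses (p_law : offspring_law p) (eta_law : threshold_law eta).

Let term (v : R) (n : nat) : R := 2 ^- n.-1 * p n *
  \sum_(1 <= k < n.+1) (eta n k * binomial_tail n k (1 + v)).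

Let voteE (v : R) : voteF p eta v = limn (fun N => \sum_(1 <= n < N) term v n) - 1.
Proof.
rewrite /voteF; congr (_ + _); congr (limn _); apply/funext => N; apply: eq_bigr => n _; congr (_ * _).
apply: eq_bigr => k _; congr (_ * _); apply: eq_bigr => j _.
by congr (_ * _ ^+ _); ring.
Qed.

Let term_le (v w : R) n : -1 <= v -> v <= w -> w <= 1 -> (1 <= n)%N ->
  0 <= term v n <= term w n.
Proof.
move=> v1 vw w1 n1; have [p0 _] := p_law; have [e0 _] := eta_law n1.
have c0 : 0 <= 2 ^- n.-1 * p n by rewrite mulr_ge0 ?p0// invr_ge0 exprn_ge0.
have v2 : 0 <= 1 + v <= 2 by apply/andP; split; lra.
apply/andP; split.
  rewrite mulr_ge0// big_nat_cond sumr_ge0// => k; rewrite andbT ltnS => k1.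
  by rewrite mulr_ge0 ?e0// binomial_tail_ge0.
rewrite ler_wpM2l// big_nat_cond [leRHS]big_nat_cond ler_sum// => k.
rewrite andbT ltnS => k1; rewrite ler_wpM2l ?e0//.
by apply: binomial_tail_homo; lra.
Qed.

Let term1 n : (1 <= n)%N -> term 1 n = 2 * p n.
Proof.
move=> n1; have [_ e1] := eta_law n1; rewrite /term.
have -> : \sum_(1 <= k < n.+1) (eta n k * binomial_tail n k (1 + 1)) = 2 ^+ n.
  transitivity ((\sum_(1 <= k < n.+1) eta n k) * 2 ^+ n); last by rewrite e1 mul1r.
  rewrite mulr_suml; apply: eq_big_nat => k /andP[_ kn].
  by rewrite binomial_tail2.
case: n n1 {e1} => // n _ /=.
by rewrite exprS mulrAC mulrCA mulVf ?mulr1// expf_neq0// pnatr_eq0.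
Qed.

Let term_sum_nd (v : R) : -1 <= v -> v <= 1 ->
  {homo (fun N => \sum_(1 <= n < N) term v n) : n m / (n <= m)%N >-> n <= m}.
Proof.
move=> v1 v2; apply/nondecreasing_seqP => -[|N]; first by rewrite !big_geq.
rewrite [leRHS]big_nat_recr//= lerDl.
by have /andP[] := term_le v1 (lexx v) v2 (ltn0Sn N).
Qed.

(** At [v = 1] every child votes 1 and all tails equal [2^n], so the terms reduce to [2 * p n]. This
    series also dominates the one at any other [v] in [[-1, 1]]. *)
Let cvg_term1 : \sum_(1 <= n < N) term 1 n @[N --> \oo] --> (2 : R).
Proof.
have [_ ps] := p_law.
rewrite (_ : (fun N => _) = (fun N => 2 * \sum_(1 <= n < N) p n)); last first.
  apply/funext => N; rewrite mulr_sumr; apply: eq_big_nat => n /andP[n1 _].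
  exact: term1.
by rewrite -[X in _ --> X]mulr1; exact: cvgMl_tmp.
Qed.

Let cvg_term (v : R) : -1 <= v -> v <= 1 -> cvgn (fun N => \sum_(1 <= n < N) term v n).
Proof.
move=> v1 v2; apply: nondecreasing_is_cvgn; first exact: term_sum_nd.
exists 2 => _ [N _ <-].
have c1 : cvgn (fun N => \sum_(1 <= n < N) term 1 n) by apply/cvg_ex; exists 2.
have nd1 := @term_sum_nd 1 (le_trans v1 v2) (lexx 1).
have := nondecreasing_cvgn_le nd1 c1 N.
rewrite (cvg_lim _ cvg_term1)//; apply: le_trans.
rewrite big_nat_cond [leRHS]big_nat_cond ler_sum// => n /andP[/andP[n1 _] _].
by have /andP[] := term_le v1 v2 (lexx 1) n1.
Qed.

Lemma voteF1 : voteF p eta 1 = 1.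
Proof. by rewrite voteE (cvg_lim _ cvg_term1)//; ring. Qed.

Lemma voteF_homo (v w : R) : -1 <= v -> v <= w -> w <= 1 -> voteF p eta v <= voteF p eta w.
Proof.
move=> v1 vw w1; rewrite !voteE lerD2r; apply: ler_lim.
- by apply: cvg_term => //; exact: le_trans w1.
- by apply: cvg_term => //; exact: le_trans vw.
near=> N; rewrite big_nat_cond [leRHS]big_nat_cond ler_sum// => n /andP[/andP[n1 _] _].
by have /andP[] := term_le v1 vw w1 n1.
Unshelve. all: by end_near. Qed.

End vote.

(** * One-sided derivatives and the Lipschitz bound for the vote function *)

Section derivative_within.
Variable R : realType.
Implicit Types (f : R -> R) (A : set R).

Lemma derivative_within_cvg A f (x l : R) :
  derivative_within A f x l -> f y @[y --> within A (nbhs x)] --> f x.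
Proof.
move=> /cvgrPdist_lt /(_ 1 ltr01) [d /= d0 dP].
have l1 : 0 < `|l| + 1 by rewrite ltr_wpDl.
apply/cvgrPdist_lt => e e0; exists (Num.min d (e / (`|l| + 1))) => /=.
  by rewrite lt_min d0 divr_gt0.
move=> y /=; rewrite lt_min => /andP[xyd xye] Ay.
have [->|yx] := eqVneq y x; first by rewrite subrr normr0.
have yx0 : y - x != 0 by rewrite subr_eq0.
have := dP y xyd yx Ay.
rewrite distrC => /(le_lt_trans (lerB_dist _ _)); rewrite ltrBlDr => H.
rewrite distrC -(divfK yx0 (f y - f x)) normrM.
rewrite (lt_le_trans (_ : _ < (`|l| + 1) * `|y - x|))//.
  by rewrite ltr_pM2r ?normr_gt0// [_ + 1]addrC.
by rewrite mulrC -ler_pdivlMr// distrC ltW.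
Qed.

Lemma derivative_within_is_derive (a b : R) f (x l : R) : a < x < b ->
  derivative_within `[a, b] f x l -> is_derive x 1 f l.
Proof.
move=> /andP[ax xb] dl.
have H : h^-1 *: (f (h *: 1 + x) - f x) @[h --> 0^'] --> l.
  apply/cvgrPdist_lt => e e0.
  have /cvgrPdist_lt/(_ e e0)[d /= d0 dP] := dl.
  exists (Num.min d (Num.min (x - a) (b - x))) => /=.
    by rewrite !lt_min d0 !subr_gt0 ax xb.
  move=> h /=; rewrite sub0r normrN !lt_min => /and3P[hd ha hb] h0.
  have := dP (h + x) => /=; rewrite opprD addrCA subrr addr0 normrN => /(_ hd).
  rewrite addrK scaler1 /GRing.scale/= mulrC; apply.
    by rewrite -subr_eq0 addrK.
  rewrite in_itv/=; move: ha hb; rewrite !ltr_norml => /andP[? ?] /andP[? ?].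
  by apply/andP; split; lra.
apply: DeriveDef; first by apply/cvg_ex; exists l.
exact: cvg_lim.
Qed.

(** The first derivative is itself differentiable, hence continuous on the compact interval; the
    maximum of its absolute value is a Lipschitz constant by the mean value theorem. *)
Lemma C2_lipschitz (f : R -> R) : C2_on `[0, 1] f ->
  exists2 L : R, 0 <= L & forall v w : R, 0 <= v <= 1 -> 0 <= w <= 1 ->
    `|f v - f w| <= L * `|v - w|.
Proof.
move=> [f1 [f2 [df df1 _]]].
have cf (g h : R -> R) : (forall x, `[(0:R), 1]%classic x -> derivative_within `[0, 1] g x (h x)) ->
    {within `[0, 1], continuous g}.
  move=> dg; rewrite continuous_subspace_in => x; rewrite inE => x01.
  have := derivative_within_cvg (dg x x01).
  by rewrite (nbhs_subspace_in x01).
have c1 : {within `[0, 1], continuous (fun x => `|f1 x|)}.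
  move=> x; apply: (@continuous_comp _ _ _ (f1 : subspace _ -> R) (@Num.norm R R)).
    exact: (cf _ _ df1).
  exact: norm_continuous.
have [c _ cM] := EVT_max ler01 c1.
exists `|f1 c| => //.
suff H (v w : R) : 0 <= v -> v <= w -> w <= 1 -> `|f w - f v| <= `|f1 c| * `|w - v|.
  move=> v w /andP[v0 v1] /andP[w0 w1]; have [vw|/ltW wv] := leP v w.
    by rewrite distrC (distrC v); exact: H.
  exact: H.
move=> v0 vw w1.
have [||z zvw ->] := @MVT_segment R f f1 v w vw.
- move=> z; rewrite in_itv/= => /andP[vz zw].
  apply: (@derivative_within_is_derive 0 1); first by rewrite (le_lt_trans v0)//= (lt_le_trans zw).
  by apply: df; rewrite /= in_itv/= (ltW (le_lt_trans v0 vz)) (ltW (lt_le_trans zw w1)).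
- apply: continuous_subspaceW (cf _ _ df).
  by move=> z /=; rewrite !in_itv/= => /andP[vz zw]; rewrite (le_trans v0)//= (le_trans zw).
rewrite normrM ler_wpM2r// cM// in_itv/=.
by move: zvw; rewrite in_itv/= => /andP[vz zw]; rewrite (le_trans v0)//= (le_trans zw).
Qed.

Lemma odd_lipschitz (f : R -> R) (L : R) : odd_on_unit f ->
  (forall v w : R, 0 <= v <= 1 -> 0 <= w <= 1 -> `|f v - f w| <= L * `|v - w|) ->
  forall v w : R, -1 <= v <= 1 -> -1 <= w <= 1 -> `|f v - f w| <= L * `|v - w|.
Proof.
move=> fo fL.
have f0 : f 0 = 0.
  have := fo 0; rewrite oppr0 => /(_ _)/eqP; rewrite -addr_eq0 -mulr2n mulrn_eq0/= => H.
  by apply/eqP/H; rewrite lerN10 ler01.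
suff H (v w : R) : -1 <= v -> v <= w -> w <= 1 -> `|f v - f w| <= L * `|v - w|.
  move=> v w /andP[v0 v1] /andP[w0 w1]; have [vw|/ltW wv] := leP v w; first exact: H.
  by rewrite distrC (distrC v); exact: H.
move=> v1 vw w1; have [v0|v0] := leP 0 v.
  by apply: fL; apply/andP; split => //; [exact: le_trans w1|exact: le_trans vw].
have fvN : f v = - f (- v) by rewrite -{1}(opprK v) fo//; apply/andP; split; lra.
have [w0|w0] := leP 0 w.
  (* For [v < 0 <= w] the estimate passes through [f 0 = 0], and [|v| + |w|] is exactly
     [|v - w|]. *)
  have h1 : `|f (- v) - f 0| <= L * `|- v - 0| by apply: fL; apply/andP; split; lra.
  have h2 : `|f w - f 0| <= L * `|w - 0| by apply: fL; apply/andP; split; lra.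
  rewrite fvN -opprD normrN (le_trans (ler_normD _ _))//.
  move: h1 h2; rewrite f0 !subr0 (gtr0_norm (_ : 0 < - v)) ?oppr_gt0//.
  rewrite (ger0_norm w0) => h1 h2; rewrite (le_trans (lerD h1 h2))//.
  by rewrite ler0_norm ?subr_le0// opprB -mulrDr addrC.
have fwN : f w = - f (- w) by rewrite -{1}(opprK w) fo//; apply/andP; split; lra.
rewrite fvN fwN -opprD normrN.
have -> : `|v - w| = `|- v - - w| by rewrite -opprD normrN.
by apply: fL; apply/andP; split; lra.
Qed.

End derivative_within.

(** * Gaussian integrals *)

(** Used with [c = 0] for the symmetry in space and with [c = t] for the time reversal in Duhamel's
    formula. *)
Definition reflect (R : realType) (c : R) : measurableTypeR R -> measurableTypeR R :=
  fun x => c - x.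

Lemma measurable_reflect (R : realType) (c : R) : measurable_fun setT (reflect c).
Proof. exact: measurable_funB. Qed.

HB.instance Definition _ (R : realType) (c : R) :=
  isMeasurableFun.Build _ _ _ _ (reflect c) (measurable_reflect c).

(** By uniqueness of Lebesgue measure it suffices to test half-open intervals; the preimage is
    half-open on the other side, which has the same length. *)
Lemma pushforward_lebesgue_reflect (R : realType) (c : R) (A : set (measurableTypeR R)) :
  measurable A ->
  pushforward lebesgue_measure (reflect c) A = lebesgue_measure A.
Proof.
move=> mA; apply/esym.
apply: lebesgue_measure_unique => // X [[a b]] /= _ <-.
rewrite /pushforward/=.
have -> : reflect c @^-1` `]a, b]%classic = `[c - b, c - a[%classic.
  by apply/seteqP; split => x /=; rewrite !in_itv/= /reflect => /andP[? ?]; apply/andP; lra.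
rewrite !lebesgue_measure_itv/= !lte_fin.
have -> : (c - b < c - a) = (a < b) by apply/idP/idP; lra.
by case: ifP => // _; rewrite -!EFinB; congr EFin; lra.
Qed.

Lemma ge0_integral_reflect (R : realType) (c : R) (f : R -> \bar R) :
  measurable_fun setT f -> (forall x, 0%E <= f x)%E ->
  (\int[lebesgue_measure]_x f (c - x)%R = \int[lebesgue_measure]_x f x)%E.
Proof.
move=> mf f0.
have := ge0_integral_pushforward (measurable_reflect c) lebesgue_measure measurableT mf (fun x _ => f0 x).
rewrite /= preimage_setT => <-.
by apply: eq_measure_integral => A mA _; exact: pushforward_lebesgue_reflect.
Qed.

Lemma integral_reflect (R : realType) (c : R) (f : R -> \bar R) :
  measurable_fun setT f ->
  (\int[lebesgue_measure]_x f (c - x)%R = \int[lebesgue_measure]_x f x)%E.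
Proof.
move=> mf; rewrite integralE [RHS]integralE; congr (_ - _)%E.
  rewrite -[RHS](ge0_integral_reflect c)//; last exact: measurable_funepos.
  by apply: eq_integral => x _; rewrite !funeposE.
rewrite -[RHS](ge0_integral_reflect c)//; last exact: measurable_funeneg.
by apply: eq_integral => x _; rewrite !funenegE.
Qed.

Definition Phi (R : realType) (z : R) : R :=
  \int[lebesgue_measure]_(t in `]-oo, z]) normal_pdf 0 1 t.

Lemma Phi_is_derive (R : realType) (z : R) :
  is_derive z 1 (@Phi R) (normal_pdf 0 1 z).
Proof.
have [] := @continuous_FTC1 R (normal_pdf 0 1) -oo%O z (z + 1).
- by rewrite ltrDl.
- by apply: integrableS (integrable_normal_pdf 0 1).
- by rewrite ltNyr.
- exact: continuous_normal_pdf.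
- move=> dP PE; apply: DeriveDef => //; by rewrite -derive1E.
Qed.

Lemma PhiE (R : realType) (z : R) :
  normal_prob 0 1 `]-oo, z]%classic = (Phi z)%:E.
Proof.
rewrite /Phi /Rintegral fineK//; apply: integrable_fin_num => //.
by apply: integrableS (integrable_normal_pdf 0 1).
Qed.

(** The identity, viewed as a random variable under the standard normal law, has [Phi] as its
    distribution function; monotonicity and the limits of [Phi] at infinity follow from those of a
    [cdf]. *)
Definition idR (R : realType) : measurableTypeR R -> R := idfun.
HB.instance Definition _ (R : realType) :=
  isMeasurableFun.Build _ _ (measurableTypeR R) R (@idR R) (@measurable_id _ _ setT).

Lemma cdf_idR (R : realType) (z : R) :
  cdf (P := normal_prob 0 1) (@idR R : {RV (normal_prob 0 1) >-> R}) z = (Phi z)%:E.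
Proof. by rewrite -PhiE. Qed.

Lemma Phi_nondecreasing (R : realType) : {homo @Phi R : x y / x <= y}.
Proof.
move=> x y xy; rewrite -lee_fin -!cdf_idR; exact: cdf_nondecreasing.
Qed.

Lemma Phi_cvgy (R : realType) : @Phi R z @[z --> +oo] --> (1 : R).
Proof.
have := cvg_cdfy1 (P := normal_prob 0 1) (@idR R : {RV (normal_prob 0 1) >-> R}).
rewrite (_ : cdf _ = EFin \o @Phi R); last by apply/funext => z; exact: cdf_idR.
by move/fine_cvgP => [].
Qed.

Lemma Phi_cvgNy (R : realType) : @Phi R z @[z --> -oo] --> (0 : R).
Proof.
have := cvg_cdfNy0 (P := normal_prob 0 1) (@idR R : {RV (normal_prob 0 1) >-> R}).
rewrite (_ : cdf _ = EFin \o @Phi R); last by apply/funext => z; exact: cdf_idR.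
by move/fine_cvgP => [].
Qed.

Lemma normal_pdf_scale (R : realType) (s x y : R) : 0 < s ->
  normal_pdf x (Num.sqrt s) y =
  (Num.sqrt s)^-1 * normal_pdf 0 1 ((y - x) / Num.sqrt s).
Proof.
move=> s0; have r0 : 0 < Num.sqrt s by rewrite sqrtr_gt0.
rewrite !normal_pdfE ?oner_eq0 ?gt_eqF// /normal_peak /normal_fun.
rewrite subr0 expr1n mul1r -mulrnAr sqrtrM ?sqr_ge0// sqrtr_sqr gtr0_norm// invfM.
rewrite mulrA; congr (_ * expR _).
by field; rewrite gt_eqF.
Qed.

Lemma integral0y_normal_pdf (R : realType) (t x : R) : 0 < t ->
  (\int[lebesgue_measure]_(y in `[0%R, +oo[) (normal_pdf x (Num.sqrt t) y)%:E =
   (1 - Phi (- x / Num.sqrt t))%R%:E)%E.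
Proof.
move=> t0; have r0 : 0 < Num.sqrt t by rewrite sqrtr_gt0.
have dF (y : R) : is_derive y 1 (fun y : R => Phi ((y - x) / Num.sqrt t))
    (normal_pdf x (Num.sqrt t) y).
  rewrite normal_pdf_scale// mulrC.
  apply: (@is_derive1_comp R (@Phi R)); first exact: Phi_is_derive.
  by apply: is_derive_eq; rewrite scaler0 add0r subr0 scaler1.
rewrite (@ge0_continuous_FTC2y R _ (fun y => Phi ((y - x) / Num.sqrt t)) 0 1).
- by rewrite sub0r.
- by move=> y _; exact: normal_pdf_ge0.
- by apply: continuous_subspaceT; apply: continuous_normal_pdf; rewrite gt_eqF.
- apply: (cvg_comp _ _ _ (@Phi_cvgy R)).
  by apply/gt0_cvgMly; [rewrite invr_gt0|exact: cvg_addrr].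
- by move=> y _; exact: ex_derive.
- apply: cvg_at_right_filter.
  have : {for 0, continuous (fun y : R => Phi ((y - x) / Num.sqrt t))}.
    by apply/differentiable_continuous/derivable1_diffP; exact: ex_derive.
  exact.
- by move=> y _; rewrite derive1E; exact: derive_val.
Qed.

Lemma measurable_sg (R : realType) : measurable_fun setT (@Num.sg R).
Proof.
apply: nondecreasing_measurable => // y z yz.
by case: sgrP yz => [->|y0|y0]; case: sgrP => z0; lra.
Qed.

Lemma integrable_normal_pdf_sg (R : realType) (r x : R) :
  lebesgue_measure.-integrable setT (fun y => (normal_pdf x r y * Num.sg y)%:E).
Proof.
apply: le_integrable (integrable_normal_pdf x r) => //.
  apply/measurable_EFinP; apply: measurable_funM; last exact: measurable_sg.
  exact: measurable_normal_pdf.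
move=> y _; rewrite /= lee_fin normrM ler_piMr// normr_sg.
by case: (y != 0).
Qed.

(** The mass of the right half-line minus that of the left, where the two masses add up to 1. *)
Lemma Rintegral_normal_pdf_sg (R : realType) (t x : R) : 0 < t ->
  \int[lebesgue_measure]_y (normal_pdf x (Num.sqrt t) y * Num.sg y) =
  1 - 2 * Phi (- x / Num.sqrt t).
Proof.
move=> t0.
have ip := integrable_normal_pdf x (Num.sqrt t).
have isg := integrable_normal_pdf_sg (Num.sqrt t) x.
have -> : [set: R] = `]-oo, 0[%classic `|` `[0, +oo[%classic.
  by apply/seteqP; split => y //= _; rewrite !in_itv/= andbT; case: (ltP y 0); [left|right].
have iS (A : set R) : measurable A -> lebesgue_measure.-integrable A
    (EFin \o (fun y => (normal_pdf x (Num.sqrt t) y * Num.sg y))).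
  by move=> mA; exact: integrableS isg.
have ipS (A : set R) : measurable A -> lebesgue_measure.-integrable A
    (EFin \o (fun y => normal_pdf x (Num.sqrt t) y)).
  by move=> mA; exact: integrableS ip.
have dis : [disjoint `]-oo, (0 : R)[%classic & `[0, +oo[%classic].
  by apply/disj_setPS => y /=; rewrite !in_itv/= andbT => -[]; lra.
rewrite Rintegral_setU//; last by apply: iS; exact: measurableU.
rewrite -Rintegral_itv_obnd_cbnd; last exact: iS.
rewrite (_ : \int[@lebesgue_measure R]_(y in `]0%R, +oo[) _ =
             \int[lebesgue_measure]_(y in `]0%R, +oo[) normal_pdf x (Num.sqrt t) y); last first.
  apply: eq_Rintegral => y; rewrite inE/= in_itv/= andbT => y0.
  by rewrite gtr0_sg// mulr1.
rewrite (@Rintegral_itv_obnd_cbnd R 0 +oo%O (normal_pdf x (Num.sqrt t))); last exact: ipS.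
rewrite (_ : \int[@lebesgue_measure R]_(y in `]-oo, 0%R[) _ =
             \int[lebesgue_measure]_(y in `]-oo, 0%R[) (-1 * normal_pdf x (Num.sqrt t) y)); last first.
  apply: eq_Rintegral => y; rewrite inE/= in_itv/= => y0.
  by rewrite ltr0_sg// mulrC.
rewrite RintegralZl//; last exact: ipS.
have : \int[lebesgue_measure]_(y in (`]-oo, (0:R)[%classic `|` `[0, +oo[%classic))
    normal_pdf x (Num.sqrt t) y = 1.
  rewrite (_ : _ `|` _ = setT) ?/Rintegral ?integral_normal_pdf//.
  by apply/seteqP; split => y //= _; rewrite !in_itv/= andbT; case: (ltP y 0); [left|right].
rewrite Rintegral_setU//; last by apply: ipS; exact: measurableU.
rewrite {2 4}/Rintegral integral0y_normal_pdf//=.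
by lra.
Qed.

Lemma normal_pdf01E (R : realType) (z : R) :
  normal_pdf 0 1 z = normal_peak 1 * expR (- z ^+ 2 / 2).
Proof.
by rewrite normal_pdfE ?oner_eq0// /normal_fun subr0 expr1n.
Qed.

Lemma normal_pdfNN (R : realType) (s x y : R) : 0 < s ->
  normal_pdf (- x) (Num.sqrt s) (- y) = normal_pdf x (Num.sqrt s) y.
Proof.
move=> s0; rewrite (@normal_pdf_scale R s x y s0) (@normal_pdf_scale R s _ _ s0).
rewrite !normal_pdf01E !expr_div_n (_ : (- y - - x) ^+ 2 = (y - x) ^+ 2)//.
by ring.
Qed.

Lemma continuous_expR_normal_pdf (R : realType) (c x y s : R) : 0 < s ->
  {for s, continuous (fun s => expR (- (c * s)) * normal_pdf x (Num.sqrt s) y)}.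
Proof.
move=> s0; have r0 : 0 < Num.sqrt s by rewrite sqrtr_gt0.
have cV : (Num.sqrt z)^-1 @[z --> s] --> (Num.sqrt s)^-1.
  by apply: cvgV; [rewrite gt_eqF|exact: sqrt_continuous].
have : expR (- (c * z)) * ((Num.sqrt z)^-1 * normal_pdf 0 1 ((y - x) / Num.sqrt z))
    @[z --> s] --> expR (- (c * s)) * normal_pdf x (Num.sqrt s) y.
  rewrite normal_pdf_scale//; apply: cvgM.
    apply: (@cvg_comp _ _ _ (fun z => - (c * z)) expR _ (nbhs (- (c * s)))).
      by apply: cvgN; apply: cvgMl_tmp; exact: cvg_id.
    exact: continuous_expR.
  apply: cvgM => //.
  apply: (@cvg_comp _ _ _ (fun z => (y - x) / Num.sqrt z) (normal_pdf 0 1) _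
    (nbhs ((y - x) / Num.sqrt s))).
    exact: cvgMl_tmp.
  by apply: continuous_normal_pdf; rewrite oner_eq0.
apply: cvg_trans; apply: near_eq_cvg; near=> z.
by rewrite normal_pdf_scale//; near: z; exact: lt_nbhsr.
Unshelve. all: by end_near. Qed.

(** * The Laplace transform in time of the heat kernel *)

Section laplace.
Variables (R : realType) (k d : R).
Hypotheses (k0 : 0 < k) (d0 : 0 <= d).

(* s |-> G (sqrt s) is the classical antiderivative, in terms of the error
   function, of e^(-k^2 s / 2) times the heat kernel at distance d. *)
Let G (r : R) := (expR (- (k * d)) * Phi (k * r - d / r) -
                  expR (k * d) * Phi (- (k * r + d / r))) / k.

Let r_cvgy : @Num.sqrt R s @[s --> +oo] --> +oo.
Proof.
apply/cvgryPge => A; near=> s.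
have [A0|A0] := leP A 0; first by rewrite (le_trans A0)// sqrtr_ge0.
rewrite -[A]gtr0_norm// -sqrtr_sqr ler_sqrt.
  by near: s; apply: nbhs_pinfty_ge; rewrite num_real.
by near: s; apply: nbhs_pinfty_ge; rewrite num_real.
Unshelve. all: by end_near. Qed.

Let G_cvgy : G r @[r --> +oo] --> expR (- (k * d)) / k.
Proof.
have -> : expR (- (k * d)) / k = (expR (- (k * d)) * 1 - expR (k * d) * 0) / k.
  by rewrite mulr1 mulr0 subr0.
apply: cvgMr_tmp.
have H : k * r - d / r @[r --> +oo] --> +oo.
  apply: (@ger_cvgy _ _ _ _ (fun r => k * r + - d)).
    near=> r; rewrite lerD2l lerN2 ler_pdivrMr.
      by rewrite ler_peMr//; near: r; apply: nbhs_pinfty_ge; rewrite num_real.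
    by near: r; apply: nbhs_pinfty_gt; rewrite num_real.
  apply: (cvg_comp (fun r => k * r) _ _ (cvg_addrr _)).
  by apply: gt0_cvgMry.
apply: cvgB.
  apply: cvgMl_tmp.
  exact: (cvg_comp _ _ H (@Phi_cvgy R)).
apply: cvgMl_tmp.
apply: (cvg_comp _ _ _ (@Phi_cvgNy R)).
apply/cvgNry.
apply: (@ger_cvgy _ _ _ _ (fun r => k * r)).
  near=> r.
  have r0 : 0 <= r by near: r; apply: nbhs_pinfty_ge; rewrite num_real.
  by rewrite opprfctE opprK lerDl divr_ge0.
by apply: gt0_cvgMry.
Unshelve. all: by end_near. Qed.

Let Phi_cont : continuous (@Phi R).
Proof.
by move=> z; apply/differentiable_continuous/derivable1_diffP; have [] := Phi_is_derive z.
Qed.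

Let G_cvg0 : G r @[r --> 0^'+] --> 0.
Proof.
(* For [d = 0] both arguments of [Phi] tend to 0 and the two terms cancel; for [d > 0] the quotient
   [d / r] drives both arguments to [-oo]. *)
move: d0; rewrite le_eqVlt => /predU1P[d00|dp].
  rewrite (_ : G = fun r => (Phi (k * r) - Phi (- k * r)) * k^-1); last first.
    by apply/funext => r; rewrite /G -d00 mulr0 oppr0 expR0 mul0r subr0 addr0 !mul1r mulNr.
  have E : (Phi (k * 0) - Phi (- k * 0)) * k^-1 = 0 by rewrite !mulr0 subrr mul0r.
  have H c : Phi (c * r) @[r --> (0:R)] --> Phi (c * 0).
    apply: (@cvg_comp _ _ _ (fun r => c * r) (@Phi R) _ (nbhs (c * 0))).
      by apply: cvgMl_tmp; exact: cvg_id.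
    exact: Phi_cont.
  rewrite -[X in _ --> X]E.
  by apply: cvgMr_tmp; apply: cvgB; apply: cvg_at_right_filter; exact: H.
have E : (expR (- (k * d)) * 0 - expR (k * d) * 0) * k^-1 = 0.
  by rewrite !mulr0 subr0 mul0r.
have H (c : R) : d / r - c @[r --> 0^'+] --> +oo.
  apply/cvgryPge => A; near=> r.
  have r0 : 0 < r by [].
  rewrite lerBrDr ler_pdivlMr// (@le_trans _ _ ((`|A + c| + 1) * r))//.
    by rewrite ler_wpM2r ?(ltW r0)// (le_trans (ler_norm _))// lerDl.
  rewrite mulrC -ler_pdivlMr ?ltr_wpDl//.
  near: r; apply: nbhs_right_le; rewrite divr_gt0// ltr_wpDl//.
rewrite -[X in _ --> X]E.
apply: cvgMr_tmp; apply: cvgB; apply: cvgMl_tmp; apply: (cvg_comp _ _ _ (@Phi_cvgNy R)).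
  apply/cvgNry.
  apply: (ger_cvgy _ (H k)); near=> r.
  have r1 : r <= 1 by near: r; exact: nbhs_right_le.
  by rewrite opprfctE opprB lerD2l lerN2 ler_piMr ?(ltW k0).
apply/cvgNry.
apply: (ger_cvgy _ (H 0)); near=> r.
by rewrite opprfctE opprK subr0 lerDr mulr_ge0 ?(ltW k0).
Unshelve. all: by end_near. Qed.

Let G_is_derive (r : R) : 0 < r ->
  is_derive r 1 G (2 * expR (- (k ^+ 2 / 2 * r ^+ 2)) * normal_pdf 0 1 ((0 - d) / r)).
Proof.
move=> r0.
have rn0 : r != 0 by rewrite gt_eqF.
have Ha : is_derive r 1 (fun r => k * r - d / r) (k + d / r ^+ 2).
  have Hi : is_derive r 1 (fun r : R => r^-1) (- r ^- 2 *: 1) by apply: is_deriveV.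
  by apply: is_derive_eq; rewrite /GRing.scale/=; field.
have Hb : is_derive r 1 (fun r => - (k * r + d / r)) (- (k - d / r ^+ 2)).
  have Hi : is_derive r 1 (fun r : R => r^-1) (- r ^- 2 *: 1) by apply: is_deriveV.
  by apply: is_derive_eq; rewrite /GRing.scale/=; field.
have HPa := @is_derive1_comp R (@Phi R) (fun r => k * r - d / r) r _ _ (Phi_is_derive _) Ha.
have HPb := @is_derive1_comp R (@Phi R) (fun r => - (k * r + d / r)) r _ _ (Phi_is_derive _) Hb.
rewrite (_ : G = (fun r => (expR (- (k * d)) * (@Phi R \o (fun r => k * r - d / r)) r -
   expR (k * d) * (@Phi R \o (fun r => - (k * r + d / r))) r) * k^-1))//.
apply: is_derive_eq; rewrite /GRing.scale/=.
(* Completing the square: the cross terms [k * d] of [(k r - d / r)^2] and [(k r + d / r)^2] cancel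
   against the prefactors, so both densities and the integrand share the factor [E]. *)
pose E := normal_peak (1 : R) * expR (- (k ^+ 2 * r ^+ 2 + d ^+ 2 / r ^+ 2) / 2).
have Ea : expR (- (k * d)) * normal_pdf 0 1 (k * r - d / r) = E.
  by rewrite normal_pdf01E mulrCA -expRD; congr (_ * expR _); field.
have Eb : expR (k * d) * normal_pdf 0 1 (- (k * r + d / r)) = E.
  by rewrite normal_pdf01E mulrCA -expRD; congr (_ * expR _); field.
have Ec : expR (- (k ^+ 2 / 2 * r ^+ 2)) * normal_pdf 0 1 ((0 - d) / r) = E.
  by rewrite normal_pdf01E mulrCA -expRD; congr (_ * expR _); field.
rewrite -[2 * _ * _]mulrA Ec mulr0 add0r.
rewrite [_ * (_ * (k + _))]mulrA [_ * (_ * - _)]mulrA Ea Eb.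
by field; rewrite rn0 gt_eqF.
Qed.

Let dG (s : R) : 0 < s -> is_derive s 1 (G \o Num.sqrt)
  (expR (- (k ^+ 2 / 2 * s)) * normal_pdf d (Num.sqrt s) 0).
Proof.
move=> s0; have r0 : 0 < Num.sqrt s by rewrite sqrtr_gt0.
rewrite (@normal_pdf_scale R s d 0 s0).
have := @is_derive1_comp R G Num.sqrt s _ _ (G_is_derive r0) (is_derive1_sqrt s0).
rewrite sqr_sqrtr ?ltW//; move/is_derive_eq; apply.
rewrite invfM mulrACA [2 * _ / 2]mulrAC divff ?mul1r; last by rewrite pnatr_eq0.
by rewrite [_^-1 * _]mulrC mulrA.
Qed.

Lemma integral_laplace_normal_pdf0 :
  (\int[lebesgue_measure]_(s in `]0%R, +oo[)
     (expR (- (k ^+ 2 / 2 * s)) * normal_pdf d (Num.sqrt s) 0)%:E =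
   (expR (- (k * d)) / k)%:E)%E.
Proof.
have cont (a : R) : 0 < a -> {within `[a, +oo[,
    continuous (fun s => expR (- (k ^+ 2 / 2 * s)) * normal_pdf d (Num.sqrt s) 0)}.
  move=> a0; apply: continuous_in_subspaceT => s; rewrite inE/= in_itv/= andbT => sa.
  by apply: continuous_expR_normal_pdf; exact: lt_le_trans sa.
(* For [d = 0] the integrand blows up like [s^(-1/2)] at 0. The fundamental theorem is therefore
   applied away from 0, and monotone convergence along [a = 1 / (n + 1)] gives the full integral. *)
have FTC (a : R) : 0 < a -> (\int[lebesgue_measure]_(s in `[a, +oo[)
     (expR (- (k ^+ 2 / 2 * s)) * normal_pdf d (Num.sqrt s) 0)%:E =
   (expR (- (k * d)) / k - G (Num.sqrt a))%:E)%E.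
  move=> a0; rewrite EFinB; apply: (@ge0_continuous_FTC2y R
    (fun s => expR (- (k ^+ 2 / 2 * s)) * normal_pdf d (Num.sqrt s) 0) (G \o Num.sqrt) a).
  - by move=> s _; rewrite mulr_ge0 ?expR_ge0 ?normal_pdf_ge0.
  - exact: cont.
  - exact: (cvg_comp _ _ r_cvgy G_cvgy).
  - by move=> s sa; have [] := dG (lt_trans a0 sa).
  - apply: cvg_at_right_filter.
    have : {for a, continuous (G \o Num.sqrt)}.
      by apply/differentiable_continuous/derivable1_diffP; have [] := dG a0.
    exact.
  - move=> s; rewrite in_itv/= andbT => sa.
    by rewrite derive1E; have [] := dG (lt_trans a0 sa).
rewrite itvoyEbigcup.
have GV : (expR (- (k * d)) / k - G (Num.sqrt (n.+1%:R^-1))) @[n --> \oo] -->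
    expR (- (k * d)) / k.
  rewrite -[X in _ --> X]subr0; apply: cvgB; first exact: cvg_cst.
  have /cvg_at_rightP := G_cvg0; apply; split => [n|].
    by rewrite sqrtr_gt0.
  have h : @harmonic R n @[n --> \oo] --> 0 by exact: cvg_harmonic.
  rewrite -[X in _ --> X]sqrtr0.
  exact: (@cvg_comp _ _ _ (@harmonic R) (@Num.sqrt R) _ _ _ h (@sqrt_continuous R 0)).
have H := @ge0_nondecreasing_set_cvg_integral _ (measurableTypeR R) R
  (fun n : nat => [set` `[(0 + n.+1%:R^-1 : R), +oo[])
  (fun s => (expR (- (k ^+ 2 / 2 * s)) * normal_pdf d (Num.sqrt s) 0)%:E) lebesgue_measure.
apply: (cvg_unique _ (H _ _ _ _)) => //.
- move=> m n mn; apply/subsetPset => s /=; rewrite !in_itv/= !andbT; apply: le_trans.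
  by rewrite lerD2l lef_pV2 ?posrE// ler_nat.
- move=> n; apply/measurable_EFinP; apply: subspace_continuous_measurable_fun => //.
 by apply: cont; rewrite add0r.
- by move=> n s _; rewrite lee_fin mulr_ge0 ?expR_ge0 ?normal_pdf_ge0.
- rewrite (_ : (fun i : nat => _) = (fun n : nat =>
    (expR (- (k * d)) / k - G (Num.sqrt (n.+1%:R^-1)))%:E)); last first.
    by apply/funext => n; rewrite -FTC// add0r.
  by apply: cvg_EFin; [near=> n|].
Unshelve. all: by end_near. Qed.

End laplace.

Lemma integral_laplace_normal_pdf (R : realType) (k x y : R) : 0 < k ->
  (\int[lebesgue_measure]_(s in `]0%R, +oo[)
     (expR (- (k ^+ 2 / 2 * s)) * normal_pdf x (Num.sqrt s) y)%:E =
   (expR (- (k * `|x - y|)) / k)%:E)%E.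
Proof.
move=> k0; rewrite -(integral_laplace_normal_pdf0 k0 (normr_ge0 (x - y))).
apply: eq_integral => s; rewrite inE/= in_itv/= andbT => s0.
congr (_ * _)%:E; rewrite (@normal_pdf_scale R s x y s0) (@normal_pdf_scale R s _ 0 s0).
rewrite !normal_pdf01E.
congr (_ * (_ * expR _)); rewrite !exprMn sub0r sqrrN -normrX ger0_norm ?sqr_ge0//.
by rewrite -(sqrrN (y - x)) opprB.
Qed.

(** * Brownian motion at an exponential time *)

Section kernel.
Variable R : realType.
Variable zeta : R.
Hypothesis zeta0 : 0 < zeta.
Notation mu := (@lebesgue_measure R).
Notation RR := (measurableTypeR R * measurableTypeR R)%type.

(** The joint density of the exponential time and of the Brownian position at that time. Extending
    it by 0 lets all integrals run over the whole plane. *)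
Definition killed_kernel (x : R) (z : RR) : R :=
  if 0 < z.1 then zeta * expR (- (zeta * z.1)) * normal_pdf x (Num.sqrt z.1) z.2
  else 0.

Lemma ker_ge0 x z : 0 <= killed_kernel x z.
Proof.
by rewrite /killed_kernel; case: ifP => // _; rewrite !mulr_ge0 ?expR_ge0 ?normal_pdf_ge0 ?ltW.
Qed.

Lemma measurable_ker x : measurable_fun setT (killed_kernel x).
Proof.
(* Writing [1 / sqrt s] as [expR (- ln s / 2)] displays the kernel as a composition of functions
   measurable jointly in time and space. *)
rewrite (_ : killed_kernel x = fun z => if 0 < z.1 then zeta * expR (- (zeta * z.1)) *
   (expR (- (ln z.1) / 2) *
    (normal_peak 1 * expR (- ((z.2 - x) * expR (- (ln z.1) / 2)) ^+ 2 / 2))) else 0); last first.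
  apply/funext => -[s y]; rewrite /killed_kernel/=; case: ifPn => // s0.
  rewrite (@normal_pdf_scale R s x y s0) normal_pdf01E.
  have -> : (Num.sqrt s)^-1 = expR (- ln s / 2) => //.
  rewrite -{1}(lnK s0) mulNr expRN; congr (_^-1).
  by rewrite -powR12_sqrt ?expR_ge0// /powR gt_eqF ?expR_gt0// expRK mulrC.
have m1 : measurable_fun setT (fst : RR -> measurableTypeR R) by exact: measurable_fst.
have m2 : measurable_fun setT (snd : RR -> measurableTypeR R) by exact: measurable_snd.
have ml : measurable_fun setT (fun z : RR => expR (- ln z.1 / 2)).
  apply: measurableT_comp => //; apply: measurable_funM => //.
  by apply: measurableT_comp => //; apply: measurableT_comp => //; exact: measurable_ln.
apply: measurable_fun_ifT => //.
  exact: measurable_fun_ltr.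
apply: measurable_funM; first apply: measurable_funM => //.
  apply: measurableT_comp => //; apply: measurableT_comp => //.
  by apply: measurable_funM.
apply: measurable_funM => //; apply: measurable_funM => //.
apply: measurableT_comp => //; apply: measurable_funM => //.
apply: measurableT_comp => //; apply: measurable_funX.
by apply: measurable_funM => //; exact: measurable_funB.
Qed.

(** Tonelli: the Gaussian factor integrates to 1 in space, which leaves the exponential law of the
    time. *)
Lemma integral_ker (x : R) (c : R -> R) : (forall s, 0 <= c s) ->
  measurable_fun setT c ->
  (\int[(mu \x mu)%E]_z (killed_kernel x z * c z.1)%:E =
   \int[mu]_(s in `]0%R, +oo[) (zeta * expR (- (zeta * s)) * c s)%:E)%E.
Proof.
move=> c0 mc; rewrite fubini_tonelli1.
- rewrite [RHS]integral_mkcond; apply: eq_integral => s _.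
  rewrite /fubini_F/= patchE mem_setE in_itv/= andbT /killed_kernel/=; case: ifPn => s0; last first.
    by rewrite integral0_eq; [|move=> y _; rewrite mul0r].
under eq_integral do rewrite mulrAC EFinM.
  rewrite ge0_integralZl//; first by rewrite integral_normal_pdf mule1.
  + by apply/measurable_EFinP; exact: measurable_normal_pdf.
  + by move=> y _; rewrite lee_fin normal_pdf_ge0.
  + by rewrite lee_fin !mulr_ge0 ?expR_ge0// ltW.
- apply/measurable_EFinP; apply: measurable_funM; first exact: measurable_ker.
  by apply: measurableT_comp => //; exact: measurable_fst.
- by move=> z; rewrite lee_fin mulr_ge0 ?ker_ge0.
Qed.

End kernel.

Section expectation.
Variable R : realType.
Variable zeta : R.
Hypothesis zeta0 : 0 < zeta.
Notation mu := (@lebesgue_measure R).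
Notation RR := (measurableTypeR R * measurableTypeR R)%type.

Lemma integral_expR (a t : R) : 0 < a ->
  (\int[mu]_(s in `[t, +oo[) (a * expR (- (a * s)))%:E = (expR (- (a * t)))%:E)%E.
Proof.
move=> a0.
have dF (s : R) : is_derive s 1 (fun s => - expR (- (a * s))) (a * expR (- (a * s))).
  have H : is_derive s 1 (fun s => - (a * s)) (- a).
    by apply: is_derive_eq; rewrite /GRing.scale/= mulr1.
  have := @is_derive1_comp R expR (fun s => - (a * s)) s _ _ (is_derive_expR _) H => H2.
  by apply: is_derive_eq; rewrite mulrN opprK mulrC.
have cF (s : R) : {for s, continuous (fun s => - expR (- (a * s)))}.
  by apply/differentiable_continuous/derivable1_diffP; have [] := dF s.
have cf (s : R) : {for s, continuous (fun s => a * expR (- (a * s)))}.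
  rewrite (_ : (fun s => _) = (fun s => - a * - expR (- (a * s)))); last first.
    by apply/funext => z; rewrite mulrNN.
  exact: cvgMl_tmp (cF s).
rewrite -[RHS]add0e -[(expR _)%:E]oppeK -EFinN.
apply: (@ge0_continuous_FTC2y R _ (fun s => - expR (- (a * s))) t).
- by move=> s _; rewrite mulr_ge0 ?expR_ge0// ltW.
- exact: continuous_subspaceT.
- rewrite -[X in _ --> X]oppr0; apply: cvgN.
  apply: (@cvg_comp _ _ _ (fun s => a * s) (fun s => expR (- s))); last exact: cvgr_expR.
  exact: gt0_cvgMry.
- by move=> s _; have [] := dF s.
- by apply: cvg_at_right_filter; have := cF t.
- by move=> s _; rewrite derive1E; have [] := dF s.
Qed.

(* The expectation of f(T, B_T), for T exponential of rate zeta and B a Brownian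
   motion started at x and independent of T. *)
Definition Ex (x : R) (f : RR -> R) : R := \int[(mu \x mu)%E]_z (killed_kernel zeta x z * f z).

Definition bounded_measurable (f : RR -> R) :=
  measurable_fun setT f /\ exists B : R, forall z, `|f z| <= B.

Lemma integrable_ker x f : bounded_measurable f ->
  (mu \x mu)%E.-integrable setT (fun z => (killed_kernel zeta x z * f z)%:E).
Proof.
move=> [mf [B fB]].
have B0 : 0 <= B by apply: le_trans (fB (0, 0)).
apply: (@le_integrable _ _ _ _ _ _ _ (fun z => (killed_kernel zeta x z * B)%:E)) => //.
- apply/measurable_EFinP; apply: measurable_funM => //; exact: measurable_ker.
- move=> z _; rewrite /= lee_fin !normrM ler_wpM2l// (ger0_norm B0).
  exact: fB.
apply/integrableP; split.
  by apply/measurable_EFinP; apply: measurable_funM => //; exact: measurable_ker.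
under eq_integral do rewrite abse_EFin ger0_norm ?mulr_ge0 ?ker_ge0//.
rewrite (@integral_ker R zeta zeta0 x (cst B))//=.
apply: (@le_lt_trans _ _ (\int[mu]_(s in `[0%R, +oo[) (zeta * expR (- (zeta * s)) * B)%:E)%E).
  apply: ge0_subset_integral => //.
  - apply/measurable_EFinP; apply: measurable_funM => //; apply: measurable_funM => //.
    by apply: measurableT_comp => //; apply: measurableT_comp => //; exact: measurable_funM.
  - by move=> s _; rewrite lee_fin !mulr_ge0 ?expR_ge0// ltW.
  - by apply: subset_itvr; rewrite bnd_simp.
under eq_integral do rewrite EFinM.
rewrite ge0_integralZr//.
- by rewrite integral_expR// ltry.
- apply/measurable_EFinP; apply: measurable_funM => //.
  by apply: measurableT_comp => //; apply: measurableT_comp => //; exact: measurable_funM.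
- by move=> s _; rewrite lee_fin mulr_ge0 ?expR_ge0// ltW.
Qed.

Lemma bmeas_cst (c : R) : bounded_measurable (fun=> c).
Proof. by split => //; exists `|c|. Qed.

Lemma bmeasM f g : bounded_measurable f -> bounded_measurable g -> bounded_measurable (fun z => f z * g z).
Proof.
move=> [mf [B fB]] [mg [C gC]]; split; first exact: measurable_funM.
by exists (B * C) => z; rewrite normrM ler_pM.
Qed.

Lemma bmeasD f g : bounded_measurable f -> bounded_measurable g -> bounded_measurable (fun z => f z + g z).
Proof.
move=> [mf [B fB]] [mg [C gC]]; split; first exact: measurable_funD.
by exists (B + C) => z; rewrite (le_trans (ler_normD _ _))// lerD.
Qed.

Lemma bmeasB f g : bounded_measurable f -> bounded_measurable g -> bounded_measurable (fun z => f z - g z).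
Proof.
move=> [mf [B fB]] [mg [C gC]]; split; first exact: measurable_funB.
by exists (B + C) => z; rewrite (le_trans (ler_normB _ _))// lerD.
Qed.

Lemma bmeas_norm f : bounded_measurable f -> bounded_measurable (fun z => `|f z|).
Proof.
move=> [mf [B fB]]; split; first exact: measurableT_comp.
by exists B => z; rewrite normr_id.
Qed.

Lemma bmeas_bool (P : RR -> bool) : measurable_fun setT P -> bounded_measurable (fun z => (P z)%:R).
Proof.
move=> mP; split.
  rewrite (_ : (fun _ => _) = (fun z => if P z then 1 else 0)); last first.
    by apply/funext => z; case: (P z).
  exact: measurable_fun_ifT.
by exists 1 => z; case: (P z); rewrite ?normr1 ?normr0.
Qed.

Lemma bmeas_sg : bounded_measurable (fun z => Num.sg z.2).
Proof.
split.
  by apply: measurableT_comp; [exact: measurable_sg|exact: measurable_snd].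
by exists 1 => z; rewrite normr_sg; case: (_ != 0).
Qed.

Lemma ExB x f g : bounded_measurable f -> bounded_measurable g -> Ex x (fun z => f z - g z) = Ex x f - Ex x g.
Proof.
move=> bf bg; rewrite /Ex -RintegralB//; try exact: integrable_ker.
by apply: eq_Rintegral => z _; rewrite mulrBr.
Qed.

Lemma ExD x f g : bounded_measurable f -> bounded_measurable g -> Ex x (fun z => f z + g z) = Ex x f + Ex x g.
Proof.
move=> bf bg; rewrite /Ex -RintegralD//; try exact: integrable_ker.
by apply: eq_Rintegral => z _; rewrite mulrDr.
Qed.

Lemma ExZ x c f : bounded_measurable f -> Ex x (fun z => c * f z) = c * Ex x f.
Proof.
move=> bf; rewrite /Ex -RintegralZl//; try exact: integrable_ker.
by apply: eq_Rintegral => z _; rewrite mulrCA.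
Qed.

Lemma eq_Ex x f g : (forall s y, 0 < s -> f (s, y) = g (s, y)) -> Ex x f = Ex x g.
Proof.
move=> fg; apply: eq_Rintegral => -[s y] _; rewrite /killed_kernel/=.
by case: ifPn => [/fg ->//|_]; rewrite !mul0r.
Qed.

Lemma le_Ex x f g : bounded_measurable f -> bounded_measurable g ->
  (forall s y, 0 < s -> f (s, y) <= g (s, y)) -> Ex x f <= Ex x g.
Proof.
move=> bf bg fg; apply: le_Rintegral => //; try exact: integrable_ker.
move=> [s y] _; rewrite /killed_kernel/=; case: ifPn => [s0|_]; last by rewrite !mul0r.
by rewrite ler_wpM2l ?fg// !mulr_ge0 ?expR_ge0 ?normal_pdf_ge0 ?ltW.
Qed.

Lemma normr_Ex x f : bounded_measurable f -> `|Ex x f| <= Ex x (fun z => `|f z|).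
Proof.
move=> bf; apply: (le_trans (le_normr_Rintegral _ _)) => //; first exact: integrable_ker.
rewrite le_eqVlt; apply/orP; left; apply/eqP.
by apply: eq_Rintegral => z _; rewrite normrM ger0_norm ?ker_ge0.
Qed.

Lemma measurable_section f s : bounded_measurable f -> measurable_fun setT (fun y => f (s, y)).
Proof.
by move=> [mf _]; apply: measurableT_comp => //; exact: pair1_measurable.
Qed.

Lemma fubini_ker x f s : bounded_measurable f -> 0 < s ->
  fubini_F mu (fun z => (killed_kernel zeta x z * f z)%:E) s =
  ((zeta * expR (- (zeta * s))) *
    \int[mu]_y (normal_pdf x (Num.sqrt s) y * f (s, y)))%:E.
Proof.
move=> bf s0; have [mf [B fB]] := bf.
rewrite /fubini_F /killed_kernel/= s0.
under eq_integral do rewrite -mulrA EFinM.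
have ip : mu.-integrable setT (fun y => (normal_pdf x (Num.sqrt s) y * f (s, y))%:E).
  apply: (@le_integrable _ (measurableTypeR R) R mu setT measurableT _
    (fun y => (normal_pdf x (Num.sqrt s) y * B)%:E)) => //.
  - apply/measurable_EFinP; apply: measurable_funM; first exact: measurable_normal_pdf.
    exact: measurable_section.
  - move=> y _; rewrite /= lee_fin !normrM ler_wpM2l// (le_trans (fB _))//.
    by rewrite ler_norm.
  - under eq_fun do rewrite mulrC EFinM.
    by apply: integrableZl => //; exact: integrable_normal_pdf.
rewrite integralZl// [RHS]EFinM /Rintegral fineK//.
exact: integrable_fin_num.
Qed.

Lemma Ex_fubini x f : bounded_measurable f ->
  Ex x f = fine (\int[mu]_(s in `]0%R, +oo[)
    ((zeta * expR (- (zeta * s))) *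
      \int[mu]_y (normal_pdf x (Num.sqrt s) y * f (s, y)))%:E)%E.
Proof.
move=> bf.
rewrite /Ex /Rintegral -integral12_prod_meas1; last exact: integrable_ker.
congr fine; rewrite [RHS]integral_mkcond; apply: eq_integral => s _.
rewrite patchE mem_setE in_itv/= andbT; case: ifPn => s0; first exact: fubini_ker.
by apply: integral0_eq => y _; rewrite /killed_kernel/= (negbTE s0) mul0r.
Qed.

Lemma bmeas_reflect f : bounded_measurable f -> bounded_measurable (fun z => f (z.1, - z.2)).
Proof.
move=> [mf [B fB]]; split; last by exists B.
have m2 : @measurable_fun _ _ RR (measurableTypeR R) setT (fun z => - z.2).
  by apply: measurable_funN; exact: measurable_snd.
by apply: (measurableT_comp mf); apply/measurable_fun_pairP; split => //; exact: measurable_fst.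
Qed.

Lemma Ex_reflect x f : bounded_measurable f -> Ex x f = Ex (- x) (fun z => f (z.1, - z.2)).
Proof.
move=> bf; have [mf [B fB]] := bf.
have bf' := bmeas_reflect bf.
rewrite (Ex_fubini x bf) (Ex_fubini (- x) bf'); congr fine.
apply: eq_integral => s; rewrite inE/= in_itv/= andbT => s0.
congr (_ * fine _)%:E.
rewrite -[LHS](@integral_reflect R 0); last first.
  apply/measurable_EFinP; apply: measurable_funM; first exact: measurable_normal_pdf.
  exact: measurable_section.
apply: eq_integral => y _; rewrite sub0r.
by rewrite -(normal_pdfNN x (- y) s0) opprK.
Qed.

End expectation.

(** * Comparison of odd functions on the half-line *)

Section comparison.
Variable R : realType.
Variable zeta : R.
Hypothesis zeta0 : 0 < zeta.
Notation mu := (@lebesgue_measure R).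
Notation RR := (measurableTypeR R * measurableTypeR R)%type.
Notation Ex := (@Ex R zeta).

(** The exponents compare because [(y + x)^2 - (y - x)^2 = 4 x y]. *)
Lemma le_ker_opp (x s y : R) : 0 <= x -> 0 <= y -> killed_kernel zeta (- x) (s, y) <= killed_kernel zeta x (s, y).
Proof.
move=> x0 y0; rewrite /killed_kernel/=; case: ifPn => // s0.
rewrite ler_wpM2l ?mulr_ge0 ?expR_ge0 ?(ltW zeta0)//.
rewrite (@normal_pdf_scale R s x y s0) (@normal_pdf_scale R s (- x) y s0) !normal_pdf01E.
rewrite ler_wpM2l ?invr_ge0 ?sqrtr_ge0// ler_wpM2l ?normal_peak_ge0// ler_expR.
rewrite !mulNr lerN2 ler_wpM2r ?invr_ge0// !expr_div_n.
rewrite ler_wpM2r ?invr_ge0 ?sqr_ge0// opprK.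
by rewrite -subr_ge0 (_ : _ - _ = 4 * (x * y)); [rewrite !mulr_ge0|ring].
Qed.

Lemma ker_reflect (x s y : R) : killed_kernel zeta (- x) (s, - y) = killed_kernel zeta x (s, y).
Proof.
by rewrite /killed_kernel/=; case: ifPn => // s0; rewrite normal_pdfNN.
Qed.

(* E_x h = (E_x h - E_(-x) h) / 2 for odd h, and the kernel of this difference
   has the sign of y. *)
Lemma le_Ex_odd (x : R) (f g : RR -> R) : 0 <= x -> bounded_measurable f -> bounded_measurable g ->
  (forall s y : R, 0 < s -> g (s, - y) - f (s, - y) = - (g (s, y) - f (s, y))) ->
  (forall s y : R, 0 < s -> 0 < y -> f (s, y) <= g (s, y)) ->
  Ex x f <= Ex x g.
Proof.
move=> x0 bf bg hodd fg; rewrite -subr_ge0 -(ExB zeta0)//.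
have bh := bmeasB bg bf.
set h := fun z => g z - f z; rewrite -/h in bh *.
have E : Ex (- x) h = - Ex x h.
  rewrite (@Ex_reflect R zeta zeta0 (- x))// opprK -mulN1r -(ExZ zeta0)//.
  by apply: eq_Ex => s y s0; rewrite /h/= hodd// mulN1r.
suff : 0 <= Ex x h - Ex (- x) h by rewrite E opprK -mulr2n pmulrn_lge0.
rewrite /Ex -RintegralB//; try exact: integrable_ker.
apply: Rintegral_ge0 => -[s y] _; rewrite -mulrBl.
have [s0|s0] := ltP 0 s; last first.
  by rewrite /killed_kernel/= ltNge s0/= subrr mul0r.
have [y0|y0|->] := ltgtP y 0.
(* For [y < 0] both the kernel difference and [h] are nonpositive; for [y = 0] oddness forces [h] to
   vanish. *)
- rewrite -mulrNN mulr_ge0//.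
    rewrite oppr_ge0 subr_le0.
    have := @le_ker_opp x s (- y) x0 _; rewrite oppr_ge0 ltW// => /(_ isT).
    by rewrite ker_reflect; have := ker_reflect (- x) s y; rewrite opprK => ->.
  by rewrite -hodd// subr_ge0 fg// oppr_gt0.
- by rewrite mulr_ge0 ?subr_ge0 ?le_ker_opp ?fg// ltW.
- have := hodd s 0 s0; rewrite oppr0 => /eqP.
  by rewrite -addr_eq0 -mulr2n mulrn_eq0/= => /eqP h0; rewrite /h h0 mulr0.
Qed.

(** The closed form of [P_t sgn(x)] for [t > 0], which makes its monotonicity in [t] visible. *)
Definition heat_sg (t x : R) : R := 1 - 2 * Phi (- x / Num.sqrt t).

Lemma heat_sg_le1 t x : heat_sg t x <= 1.
Proof. by rewrite /heat_sg gerBl mulr_ge0// /Phi Rintegral_ge0// => *; exact: normal_pdf_ge0. Qed.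

Lemma heat_sg_noninc (s t x : R) : 0 <= x -> 0 < s -> s <= t -> heat_sg t x <= heat_sg s x.
Proof.
move=> x0 s0 st; rewrite /heat_sg lerD2l lerN2 ler_wpM2l// Phi_nondecreasing//.
rewrite !mulNr lerN2 ler_wpM2l// lef_pV2 ?posrE ?sqrtr_gt0//; last exact: lt_le_trans st.
by rewrite ler_sqrt// ltW// (lt_le_trans s0).
Qed.

Lemma bmeas_ge (t : R) : bounded_measurable (fun z : RR => (t <= z.1)%R%:R).
Proof.
apply: bmeas_bool; apply: measurable_fun_ler => //; exact: measurable_fst.
Qed.

Lemma Ex_ge (t x : R) : 0 <= t -> Ex x (fun z => (t <= z.1)%R%:R) = expR (- (zeta * t)).
Proof.
move=> t0; rewrite /Ex /Rintegral.
have mt : measurable_fun setT (fun s : measurableTypeR R => (t <= s)%R%:R : R).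
  rewrite (_ : (fun _ => _) = (fun s : measurableTypeR R => if t <= s then 1 else 0)); last first.
    by apply/funext => z; case: (t <= z).
  by apply: measurable_fun_ifT => //; exact: measurable_fun_ler.
rewrite (@integral_ker R zeta zeta0 x (fun s => (t <= s)%R%:R))//.
rewrite (_ : (\int[mu]_(s in _) _)%E = (\int[mu]_(s in `[t, +oo[) (zeta * expR (- (zeta * s)))%:E)%E).
  by rewrite integral_expR.
have me : measurable_fun setT (fun s : measurableTypeR R => zeta * expR (- (zeta * s))).
  apply: measurable_funM => //.
  by apply: measurableT_comp => //; apply: measurableT_comp => //; exact: measurable_funM.
rewrite integral_itv_obnd_cbnd; last first.
  by apply/measurable_EFinP; apply: measurable_funM; apply: measurable_funTS.
rewrite integral_mkcond [RHS]integral_mkcond; apply: eq_integral => s _.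
rewrite !patchE !mem_setE !in_itv/= !andbT.
have [ts|ts] := leP t s; first by rewrite (le_trans t0 ts) mulr1.
by case: ifPn => // _; rewrite mulr0.
Qed.

(** The absolute value keeps the weight bounded at negative times, where the kernel vanishes
    anyway. *)
Lemma bmeas_exp (l : R) : 0 <= l -> bounded_measurable (fun z : RR => expR (- (l * `|z.1|))).
Proof.
move=> l0; split.
  apply: measurableT_comp => //; apply: measurableT_comp => //; apply: measurable_funM => //.
  apply: (@measurableT_comp _ _ _ RR (measurableTypeR R) (measurableTypeR R) (@Num.norm R R)).
    exact: normr_measurable.
  exact: measurable_fst.
by exists 1 => z; rewrite ger0_norm ?expR_ge0// -expR0 ler_expR oppr_le0 mulr_ge0.
Qed.

Lemma Ex_exp (l x : R) : 0 <= l -> Ex x (fun z => expR (- (l * `|z.1|))) = zeta / (zeta + l).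
Proof.
move=> l0; rewrite /Ex /Rintegral.
have ml : measurable_fun setT (fun s : measurableTypeR R => expR (- (l * `|s|))).
  by apply: measurableT_comp => //; apply: measurableT_comp => //; exact: measurable_funM.
have zl : 0 < zeta + l by rewrite ltr_wpDr.
rewrite (@integral_ker R zeta zeta0 x (fun s => expR (- (l * `|s|))))//.
rewrite (_ : (\int[mu]_(s in _) _)%E = (\int[mu]_(s in `]0%R, +oo[)
    ((zeta / (zeta + l))%:E * ((zeta + l) * expR (- ((zeta + l) * s)))%:E))%E); last first.
  apply: eq_integral => s; rewrite inE/= in_itv/= andbT => s0.
  rewrite -EFinM (gtr0_norm s0) -mulrA -expRD mulrA divfK ?gt_eqF//.
  by rewrite -opprD -mulrDl.
have me : measurable_fun setT (fun s : measurableTypeR R => ((zeta + l) * expR (- ((zeta + l) * s)))%:E).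
  apply/measurable_EFinP; apply: measurable_funM => //.
  by apply: measurableT_comp => //; apply: measurableT_comp => //; exact: measurable_funM.
rewrite ge0_integralZl//.
- rewrite integral_itv_obnd_cbnd; last exact: measurable_funTS.
  by rewrite integral_expR// mulr0 oppr0 expR0 mule1.
- exact: measurable_funTS.
- by move=> s _; rewrite lee_fin mulr_ge0 ?expR_ge0// ltW.
- by rewrite lee_fin divr_ge0// ltW.
Qed.

(** Among odd functions bounded by 1 on the half-line, [sgn] is the largest. With [sgn] in place of
    [f], conditioning on the time [s] gives [heat_sg s x], which is at most [heat_sg t x] since [P]
    only allows times [s >= t]. *)
Lemma Ex_tail (t x : R) (P : RR -> bool) (f : RR -> R) : 0 <= x -> 0 < t ->
  measurable_fun setT P -> (forall s y : R, 0 < s -> P (s, y) = P (s, 0)) ->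
  (forall s y : R, P (s, y) -> t <= s) -> bounded_measurable f ->
  (forall s y : R, 0 < s -> f (s, - y) = - f (s, y)) ->
  (forall s y : R, 0 < s -> 0 < y -> f (s, y) <= 1) ->
  Ex x (fun z => (P z)%:R * f z) <= heat_sg t x * Ex x (fun z => (P z)%:R).
Proof.
move=> x0 t0 mP Py Pt bf fodd f1.
have bP := bmeas_bool mP.
apply: (@le_trans _ _ (Ex x (fun z => (P z)%:R * Num.sg z.2))).
  apply: le_Ex_odd => //; first exact: bmeasM.
  - by apply: bmeasM => //; exact: bmeas_sg.
  - by move=> s y s0 /=; rewrite !(Py s)// sgrN fodd//; ring.
  - by move=> s y s0 y0 /=; rewrite ler_wpM2l// gtr0_sg// f1.
rewrite -(ExZ zeta0)// -subr_ge0 -(ExB zeta0)//; last 2 first.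
- by apply: bmeasM => //; exact: bmeas_cst.
- by apply: bmeasM => //; exact: bmeas_sg.
rewrite Ex_fubini//; last first.
  apply: bmeasB; apply: bmeasM => //; [exact: bmeas_cst|exact: bmeas_sg].
apply: fine_ge0; apply: integral_ge0 => s; rewrite /= in_itv/= andbT => s0.
rewrite lee_fin !mulr_ge0 ?expR_ge0 ?(ltW zeta0)//.
have ip := integrable_normal_pdf x (Num.sqrt s).
have [Ps|Ps] := boolP (P (s, 0)); last first.
  apply: Rintegral_ge0 => y _; rewrite /= Py// (negbTE Ps).
  by rewrite mulr0 mul0r subrr mulr0.
have ts := Pt _ _ Ps.
have isg := integrable_normal_pdf_sg (Num.sqrt s) x.
rewrite (@eq_Rintegral _ _ _ mu setT (fun y => heat_sg t x * normal_pdf x (Num.sqrt s) y -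
    normal_pdf x (Num.sqrt s) y * Num.sg y)); last first.
  by move=> y _; rewrite /= Py// Ps mulr1 mul1r mulrBr mulrC.
rewrite RintegralB//; last exact: (integrableZl measurableT (heat_sg t x) ip).
rewrite RintegralZl// Rintegral_normal_pdf_sg// {1}/Rintegral integral_normal_pdf/= mulr1.
by rewrite subr_ge0 heat_sg_noninc.
Qed.

End comparison.

(** * The resolvent as the solution of an ordinary differential equation *)

Section resolvent.
Variable R : realType.
Variables zeta k : R.
Hypotheses (k0 : 0 < k) (kz : zeta = k ^+ 2 / 2).
Notation mu := (@lebesgue_measure R).
Notation RR := (measurableTypeR R * measurableTypeR R)%type.
Notation Ex := (@Ex R zeta).

Let zeta0 : 0 < zeta. Proof. by rewrite kz divr_gt0// exprn_gt0. Qed.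

(** The density of the Brownian position at the exponential time; [zeta / k] equals [k / 2] by
    [kz]. *)
Lemma integral_ker_time (x y : R) :
  (\int[mu]_s (killed_kernel zeta x (s, y))%:E = (zeta / k * expR (- (k * `|x - y|)))%:E)%E.
Proof.
have := @integral_laplace_normal_pdf R k x y k0; rewrite -kz => H.
rewrite mulrAC -mulrA EFinM -H -ge0_integralZl//; last 3 first.
- apply/measurable_EFinP; apply: subspace_continuous_measurable_fun => //.
  apply: continuous_in_subspaceT => s; rewrite inE/= in_itv/= andbT => s0.
  exact: continuous_expR_normal_pdf.
- by move=> s _; rewrite lee_fin mulr_ge0 ?expR_ge0 ?normal_pdf_ge0.
- by rewrite lee_fin ltW.
rewrite [RHS]integral_mkcond; apply: eq_integral => s _.
rewrite patchE mem_setE in_itv/= andbT /killed_kernel/=; case: ifPn => // _.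
by rewrite -EFinM mulrA.
Qed.

Lemma integrable_laplace (x : R) :
  mu.-integrable setT (fun y => (zeta / k * expR (- (k * `|x - y|)))%:E).
Proof.
apply/integrableP; split.
  apply/measurable_EFinP; apply: measurable_funM => //; apply: measurableT_comp => //.
  apply: measurableT_comp => //; apply: measurable_funM => //.
  by apply: measurableT_comp => //; exact: measurable_funB.
under eq_integral do rewrite abse_EFin ger0_norm ?mulr_ge0 ?expR_ge0 ?invr_ge0
  ?(ltW k0) ?(ltW zeta0)// -integral_ker_time.
have mk := measurable_ker zeta x.
rewrite -(@fubini_tonelli2 _ _ (measurableTypeR R) (measurableTypeR R) R mu mu
  (fun z => (killed_kernel zeta x z)%:E))//.
- have /integrableP[_] := @integrable_ker R zeta zeta0 x _ (bmeas_cst 1).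
  by under eq_integral do rewrite mulr1 abse_EFin ger0_norm ?ker_ge0//.
- exact/measurable_EFinP.
- by move=> z; rewrite lee_fin ker_ge0.
Qed.

Lemma Ex_resolvent (x : R) (g : R -> R) : bounded_measurable (fun z : RR => g z.2) ->
  Ex x (fun z => g z.2) =
  \int[mu]_y (zeta / k * expR (- (k * `|x - y|)) * g y).
Proof.
move=> bg; rewrite /Ex /Rintegral -integral21_prod_meas1; last exact: integrable_ker.
congr fine; apply: eq_integral => y _; rewrite /fubini_G/=.
under eq_integral do rewrite mulrC EFinM.
rewrite integralZl//.
  by rewrite integral_ker_time -EFinM mulrC.
apply/integrableP; split.
  have mk := measurable_ker zeta x.
  by apply/measurable_EFinP; apply: (measurableT_comp mk); exact: pair2_measurable.
under eq_integral do rewrite abse_EFin ger0_norm ?ker_ge0//.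
by rewrite integral_ker_time ltry.
Qed.

Section formula.
Variable g : R -> R.
Hypothesis bg : bounded_measurable (fun z : RR => g z.2).

Let c := zeta / k.
Let I1 (x : R) := \int[mu]_(y in `[0, x]) (expR (k * y) * g y).
Let I2 (x : R) := \int[mu]_(y in `[0, x]) (expR (- (k * y)) * g y).
Let A := c * \int[mu]_(y in `]-oo, 0%R[) (expR (k * y) * g y).
Let B := c * \int[mu]_(y in `[0%R, +oo[) (expR (- (k * y)) * g y).

(** Variation of constants for [w'' = k^2 (w - g)]: the point [x] occurs only in the exponential
    factors and in the limits of integration, so the formula can be differentiated by the
    fundamental theorem of calculus. *)
Definition resolvent_formula (x : R) : R :=
  expR (- (k * x)) * (A + c * I1 x) + expR (k * x) * (B - c * I2 x).

Let mg : measurable_fun setT g.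
Proof.
exact: (@measurable_section R (fun z => g z.2) 0 bg).
Qed.

Let mek (l : R) : measurable_fun setT (fun y : measurableTypeR R => expR (l * y)).
Proof. by apply: measurableT_comp => //; exact: measurable_funM. Qed.

Let ige : mu.-integrable setT (fun y => (expR (- (k * `|y|)) * g y)%:E).
Proof.
have [_ [M gM]] := bg.
apply: (@le_integrable _ (measurableTypeR R) R mu setT measurableT _
  (fun y => ((zeta / k)^-1 * M)%:E * (zeta / k * expR (- (k * `|0 - y|)))%:E)%E).
- apply/measurable_EFinP; apply: measurable_funM => //; apply: measurableT_comp => //.
  by apply: measurableT_comp => //; exact: measurable_funM.
- move=> y _; rewrite -EFinM /= lee_fin sub0r normrN mulrACA mulVf ?mul1r; last first.
    by rewrite mulf_neq0 ?invr_neq0 ?gt_eqF.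
  by rewrite !normrM mulrC ler_wpM2r// (le_trans (gM (0, y)))// ler_norm.
- by apply: integrableZl => //; exact: integrable_laplace.
Qed.

Let ineg : mu.-integrable `]-oo, 0%R[ (fun y => (expR (k * y) * g y)%:E).
Proof.
have : mu.-integrable `]-oo, 0%R[ (fun y => (expR (- (k * `|y|)) * g y)%:E).
  exact: integrableS ige.
apply: eq_integrable => //.
by move=> y; rewrite inE/= in_itv/= => y0; rewrite (ltr0_norm y0) mulrN opprK.
Qed.

Let ipos : mu.-integrable `[0%R, +oo[ (fun y => (expR (- (k * y)) * g y)%:E).
Proof.
have : mu.-integrable `[0%R, +oo[ (fun y => (expR (- (k * `|y|)) * g y)%:E).
  exact: integrableS ige.
apply: eq_integrable => //.
by move=> y; rewrite inE/= in_itv/= andbT => y0; rewrite (ger0_norm y0).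
Qed.

Let iseg (l x : R) : mu.-integrable `[0, x] (fun y => (expR (l * y) * g y)%:E).
Proof.
have [_ [M gM]] := bg.
apply: (@le_integrable _ (measurableTypeR R) R mu `[0, x]%classic _ _
  (cst (expR (`|l| * `|x|) * M)%:E)) => //.
- by apply/measurable_EFinP; apply: measurable_funTS; apply: measurable_funM.
- move=> y; rewrite /= in_itv/= => /andP[y0 yx]; rewrite lee_fin !normrM.
  rewrite ler_pM//; last by rewrite (le_trans (gM (0, y)))// ler_norm.
  rewrite !(ger0_norm (expR_ge0 _)) ler_expR (le_trans (ler_norm _))// normrM.
  by rewrite ler_wpM2l// (ger0_norm y0) (le_trans yx)// ler_norm.
- apply/integrableP; split => //; rewrite integral_cst//= lebesgue_measure_itv/=.
  by case: ifPn => _; rewrite ?mule0 ?ltry// -EFinB -EFinM ltry.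
Qed.

(** On each of the pieces [y < 0], [0 <= y <= x] and [x < y] the sign of [x - y] is constant, so the
    kernel factors into an exponential in [x] and one in [y]. *)
Lemma Ex_resolvent_formula (x : R) : 0 <= x -> Ex x (fun z => g z.2) = resolvent_formula x.
Proof.
move=> x0; rewrite Ex_resolvent//.
have iS : mu.-integrable setT (fun y => (c * expR (- (k * `|x - y|)) * g y)%:E).
  have [_ [M gM]] := bg.
  apply: (@le_integrable _ (measurableTypeR R) R mu setT measurableT _
    (fun y => M%:E * (zeta / k * expR (- (k * `|x - y|)))%:E)%E).
  - apply/measurable_EFinP; apply: measurable_funM => //; apply: measurable_funM => //.
    apply: measurableT_comp => //; apply: measurableT_comp => //; apply: measurable_funM => //.
    by apply: measurableT_comp => //; exact: measurable_funB.
  - move=> y _; rewrite -EFinM /= lee_fin mulrC !normrM.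
    by rewrite ler_wpM2r// (le_trans (gM (0, y)))// ler_norm.
  - by apply: integrableZl => //; exact: integrable_laplace.
have iI (i : interval R) : mu.-integrable [set` i] (fun y => (c * expR (- (k * `|x - y|)) * g y)%:E).
  exact: integrableS iS.
have -> : [set: R] = `]-oo, 0[%classic `|` (`[0, x]%classic `|` `]x, +oo[%classic).
  apply/seteqP; split => y //= _; rewrite !in_itv/= andbT.
  by have [|y0] := ltP y 0; [left|right; have [|] := leP y x; [left|right]].
have d2 : [disjoint `[0, x]%classic & `]x, +oo[%classic].
  by apply/disj_setPS => y /=; rewrite !in_itv/= andbT => -[/andP[_]] /le_lt_trans /[apply]; rewrite ltxx.
have d1 : [disjoint `]-oo, (0 : R)[%classic & (`[0, x]%classic `|` `]x, +oo[%classic)].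
  apply/disj_setPS => y /=; rewrite !in_itv/= andbT => -[y0 [/andP[]|]].
    by move=> y0'; have := lt_le_trans y0 y0'; rewrite ltxx.
  by move=> xy; have := le_lt_trans x0 (lt_trans xy y0); rewrite ltxx.
rewrite Rintegral_setU//; last 2 first.
- exact: measurableU.
- by apply: integrableS iS => //; do 2 apply: measurableU => //.
rewrite Rintegral_setU//; last by apply: integrableS iS => //; exact: measurableU.
have E1 : \int[mu]_(y in `]-oo, 0%R[) (c * expR (- (k * `|x - y|)) * g y) = expR (- (k * x)) * A.
  rewrite /A mulrA -RintegralZl//; apply: eq_Rintegral => y; rewrite inE/= in_itv/= => y0.
  rewrite ger0_norm ?subr_ge0; last by rewrite (le_trans (ltW y0)).
  rewrite mulrBr opprB addrC expRD; ring.
have E2 : \int[mu]_(y in `[0, x]) (c * expR (- (k * `|x - y|)) * g y) = expR (- (k * x)) * (c * I1 x).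
  rewrite mulrA -RintegralZl//; last exact: iseg.
  apply: eq_Rintegral => y; rewrite inE/= in_itv/= => /andP[y0 yx].
  rewrite ger0_norm ?subr_ge0//.
  rewrite mulrBr opprB addrC expRD; ring.
have E3 : \int[mu]_(y in `]x, +oo[) (c * expR (- (k * `|x - y|)) * g y) = expR (k * x) * (B - c * I2 x).
  have -> : B - c * I2 x = c * \int[mu]_(y in `]x, +oo[) (expR (- (k * y)) * g y).
    rewrite /B /I2 -mulrBr; congr (_ * _).
    exact: (@Rintegral_itvB R (fun y => expR (- (k * y)) * g y) (BLeft 0) +oo%O x).
  rewrite mulrA -RintegralZl//; last first.
    by apply: integrableS ipos => //; apply: subset_itvr; rewrite bnd_simp.
  apply: eq_Rintegral => y; rewrite inE/= in_itv/= andbT => xy.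
  rewrite ltr0_norm ?subr_lt0// opprB mulrBr opprB expRD; ring.
by rewrite E1 E2 E3 addrA -mulrDr.
Qed.

Let FTC (l x : R) : 0 < x -> {for x, continuous g} ->
  is_derive x 1 (fun x => \int[mu]_(y in `[0, x]) (expR (l * y) * g y)) (expR (l * x) * g x).
Proof.
move=> x0 gx.
have [] := @continuous_FTC1_closed R (fun y => expR (l * y) * g y) 0 x (x + 1).
- by rewrite ltrDl.
- exact: iseg.
- exact: x0.
- apply: cvgM => //.
  apply: (@cvg_comp _ _ _ (fun z => l * z) expR _ (nbhs (l * x))).
    by apply: cvgMl_tmp; exact: cvg_id.
  exact: continuous_expR.
by move=> dP PE; apply: DeriveDef; [exact: dP|rewrite -derive1E; exact: PE].
Qed.

Let dI1 (x : R) : 0 < x -> {for x, continuous g} -> is_derive x 1 I1 (expR (k * x) * g x).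
Proof. by move=> x0 gx; exact: FTC. Qed.

Let I2E x : I2 x = \int[mu]_(y in `[0, x]) (expR (- k * y) * g y).
Proof. by apply: eq_Rintegral => y _; rewrite mulNr. Qed.

Let dI2 (x : R) : 0 < x -> {for x, continuous g} -> is_derive x 1 I2 (expR (- (k * x)) * g x).
Proof.
by move=> x0 gx; rewrite (funext I2E) -mulNr; exact: FTC.
Qed.

Let de1 (x : R) : is_derive x 1 (fun x => expR (- (k * x))) (- k * expR (- (k * x))).
Proof.
have H : is_derive x 1 (fun x => - (k * x)) (- k).
  by apply: is_derive_eq; rewrite /GRing.scale/= mulr1.
have := @is_derive1_comp R expR (fun x => - (k * x)) x _ _ (is_derive_expR _) H.
by rewrite mulrC.
Qed.

Let de2 (x : R) : is_derive x 1 (fun x => expR (k * x)) (k * expR (k * x)).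
Proof.
have H : is_derive x 1 (fun x => k * x) k.
  by apply: is_derive_eq; rewrite /GRing.scale/= mulr1.
have := @is_derive1_comp R expR (fun x => k * x) x _ _ (is_derive_expR _) H.
by rewrite mulrC.
Qed.

(** In the derivative of [resolvent_formula] the contributions of [I1] and [I2] are opposite
    multiples of [g x] and cancel. In the derivative of the slope they add up to
    [- 2 * zeta * g x]. *)
Definition resolvent_slope (x : R) : R :=
  k * (expR (k * x) * (B - c * I2 x) - expR (- (k * x)) * (A + c * I1 x)).

Lemma resolvent_formula_is_derive (x : R) : 0 < x -> {for x, continuous g} ->
  is_derive x 1 resolvent_formula (resolvent_slope x).
Proof.
move=> x0 gx; have h1 := dI1 x0 gx; have h2 := dI2 x0 gx.
have e1 := de1 x; have e2 := de2 x.
rewrite /resolvent_formula /resolvent_slope.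
apply: is_derive_eq; rewrite /GRing.scale/=.
move: (I1 x) (I2 x) (expR _) (expR _) A B (g x) => i1 i2 a b a' b' gx'.
by ring.
Qed.

Lemma resolvent_slope_is_derive (x : R) : 0 < x -> {for x, continuous g} ->
  is_derive x 1 resolvent_slope (2 * zeta * (resolvent_formula x - g x)).
Proof.
move=> x0 gx; have h1 := dI1 x0 gx; have h2 := dI2 x0 gx.
have e1 := de1 x; have e2 := de2 x.
rewrite /resolvent_formula /resolvent_slope.
apply: is_derive_eq; rewrite /GRing.scale/=.
have : expR (- (k * x)) * expR (k * x) = 1 by rewrite -expRD addNr expR0.
move: (I1 x) (I2 x) (expR (- (k * x))) (expR (k * x)) A B (g x) => i1 i2 a b a' b' gx' ab.
have kn0 : k != 0 by rewrite gt_eqF.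
(* The identity [e^(-kx) e^(kx) = 1] is inserted as a factor so that what remains is a rational
   identity. *)
have E : gx' = a * b * gx' by rewrite ab mul1r.
by rewrite /c kz [gx' in RHS]E; field.
Qed.

Let Icont (l x : R) : 0 <= x ->
  (\int[mu]_(y in `[0, z]) (expR (l * y) * g y)) @[z --> x] -->
  \int[mu]_(y in `[0, x]) (expR (l * y) * g y).
Proof.
rewrite le_eqVlt => /predU1P[<-|x0].
  (* At the endpoint the integral over the single point 0 is 0, and the claim is that it vanishes in
     the limit. *)
  rewrite set_itv1 Rintegral_set1.
  exact: (parameterized_integral_cvg_left ltr01 (iseg l 1)).
have x1 : 0 <= x + 1 by rewrite addr_ge0 ?ltW.
have := parameterized_integral_continuous x1 (iseg l (x + 1)).
move=> /within_continuous_continuous; apply; first by rewrite addr_gt0.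
by rewrite in_itv/= x0 ltrDl ltr01.
Qed.

(** The integrals are continuous in their upper limit for bounded measurable [g]. This starts a
    bootstrap: the limit is continuous, hence so is its [g], and only then can the formula be
    differentiated. *)
Lemma resolvent_formula_continuous : {within `[0, +oo[, continuous resolvent_formula}.
Proof.
have H (x : R) : 0 <= x -> resolvent_formula z @[z --> x] --> resolvent_formula x.
  move=> x0; have E (l : R) : expR (l * z) @[z --> x] --> expR (l * x).
    apply: (@cvg_comp _ _ _ (fun z => l * z) expR _ (nbhs (l * x))).
      by apply: cvgMl_tmp; exact: cvg_id.
    exact: continuous_expR.
  have EN : expR (- (k * z)) @[z --> x] --> expR (- (k * x)).
    rewrite -mulNr (_ : (fun z => _) = (fun z => expR (- k * z))); first exact: E.
    by apply/funext => z; rewrite mulNr.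
  have H2 : I2 z @[z --> x] --> I2 x by rewrite (funext I2E); exact: Icont.
  apply: cvgD; apply: cvgM => //.
  - by apply: cvgD; [exact: cvg_cst|apply: cvgMl_tmp; exact: Icont].
  - by apply: cvgB; [exact: cvg_cst|exact: cvgMl_tmp].
apply/continuous_within_itvcyP; split => [x|].
  by rewrite in_itv/= andbT => x0; exact: H (ltW x0).
by apply: cvg_at_right_filter; exact: H.
Qed.

End formula.

End resolvent.

(** * Bounded solutions of a linear equation on the half-line *)

Lemma is_derive_0_cst_pos (R : realType) (f : R -> R) :
  (forall x : R, 0 < x -> is_derive x 1 f 0) -> forall x y : R, 0 < x -> 0 < y -> f x = f y.
Proof.
move=> df; suff H (x y : R) : 0 < x -> x <= y -> f x = f y.
  move=> x y x0 y0; have [xy|/ltW yx] := leP x y; first exact: H.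
  by apply/esym/H.
move=> x0 xy; have [||c _] := @MVT_segment R f (fun=> 0) x y xy.
- by move=> z; rewrite in_itv/= => /andP[xz _]; exact: df (lt_trans x0 xz).
- apply: continuous_in_subspaceT => z; rewrite inE/= in_itv/= => /andP[xz _].
  apply/differentiable_continuous/derivable1_diffP.
  by have [] := df z (lt_le_trans x0 xz).
by rewrite mul0r => /eqP; rewrite subr_eq0 => /eqP.
Qed.

(** The quantities [a] and [b] below are first integrals, so [2 k w] is a combination of [e^(kx)]
    and [e^(-kx)] with constant coefficients. Boundedness kills the growing mode, the limit at 0 the
    decaying one. *)
Lemma bounded_ode_zero (R : realType) (k M : R) (w w1 : R -> R) : 0 < k ->
  (forall x : R, 0 < x -> is_derive x 1 w (w1 x)) ->
  (forall x : R, 0 < x -> is_derive x 1 w1 (k ^+ 2 * w x)) ->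
  (forall x : R, 0 < x -> `|w x| <= M) ->
  w x @[x --> 0^'+] --> 0 ->
  forall x : R, 0 < x -> w x = 0.
Proof.
move=> k0 dw dw1 wM w0.
have de (l x : R) : is_derive x 1 (fun x => expR (l * x)) (l * expR (l * x)).
  have H : is_derive x 1 (fun x => l * x) l.
    by apply: is_derive_eq; rewrite /GRing.scale/= mulr1.
  have := @is_derive1_comp R expR (fun x => l * x) x _ _ (is_derive_expR _) H.
  by rewrite mulrC.
pose a x := expR (- k * x) * (w1 x + k * w x).
pose b x := expR (k * x) * (w1 x - k * w x).
have aE x : 0 < x -> a x = a 1.
  move=> x0; apply: (@is_derive_0_cst_pos R a _ x 1 x0 ltr01) => z z0.
  have h1 := dw z z0; have h2 := dw1 z z0; have h3 := de (- k) z.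
  rewrite /a; apply: is_derive_eq; rewrite /GRing.scale/=; ring.
have bE x : 0 < x -> b x = b 1.
  move=> x0; apply: (@is_derive_0_cst_pos R b _ x 1 x0 ltr01) => z z0.
  have h1 := dw z z0; have h2 := dw1 z z0; have h3 := de k z.
  rewrite /b; apply: is_derive_eq; rewrite /GRing.scale/=; ring.
have wE x : 0 < x -> 2 * k * w x = a 1 * expR (k * x) - b 1 * expR (- k * x).
  move=> x0; rewrite -(aE x)// -(bE x)// /a /b.
  have : expR (- k * x) * expR (k * x) = 1 by rewrite -expRD mulNr addNr expR0.
  move: (expR (- k * x)) (expR (k * x)) (w x) (w1 x) => p q r s pq.
  rewrite [LHS](_ : _ = p * q * (2 * k * r)); last by rewrite pq mul1r.
  ring.
have a1 : a 1 = 0.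
  apply/eqP; apply/negPn/negP => an0.
  have an : 0 < `|a 1| by rewrite normr_gt0.
  have M0 : 0 <= M by rewrite (le_trans _ (wM 1 ltr01)).
  (* At this point even the lower bound [1 + k x] for [e^(kx)] makes the growing mode exceed
     [2 k M + |b 1|]. *)
  pose x := (2 * k * M + `|b 1|) / (`|a 1| * k) + 1.
  have x0 : 0 < x by rewrite ltr_wpDl// divr_ge0 ?addr_ge0 ?mulr_ge0 ?(ltW k0).
  have : `|a 1| * expR (k * x) <= 2 * k * M + `|b 1|.
    rewrite -[expR _]gtr0_norm ?expR_gt0// -normrM.
    have -> : a 1 * expR (k * x) = 2 * k * w x + b 1 * expR (- k * x) by rewrite wE// subrK.
    rewrite (le_trans (ler_normD _ _))// lerD//.
      by rewrite normrM gtr0_norm ?mulr_gt0// ler_wpM2l ?mulr_ge0 ?(ltW k0)// wM.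
    rewrite normrM ler_piMr// gtr0_norm ?expR_gt0// -expR0 ler_expR mulNr oppr_le0.
    by rewrite mulr_ge0// ltW.
  apply/negP; rewrite -ltNge.
  have : 1 + k * x <= expR (k * x) by rewrite expR_ge1Dx.
  rewrite -(ler_pM2l an); apply: lt_le_trans.
  have -> : `|a 1| * (1 + k * x) = (2 * k * M + `|b 1|) + `|a 1| * (1 + k).
    by rewrite /x; field; rewrite normr_eq0 an0 gt_eqF.
  by rewrite ltrDl mulr_gt0// addr_gt0.
have b1 : b 1 = 0.
  have H : 2 * k * w x @[x --> 0^'+] --> - (b 1 * expR (- k * 0)).
    have : - (b 1 * expR (- k * x)) @[x --> 0^'+] --> - (b 1 * expR (- k * 0)).
      apply: cvgN; apply: cvgMl_tmp; apply: cvg_at_right_filter.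
      apply: (@cvg_comp _ _ _ (fun z => - k * z) expR _ (nbhs (- k * 0))).
        by apply: cvgMl_tmp; exact: cvg_id.
      exact: continuous_expR.
    apply: cvg_trans; apply: near_eq_cvg; near=> x.
    by rewrite wE// a1 mul0r sub0r.
  have H0 : 2 * k * w x @[x --> 0^'+] --> 2 * k * 0 by exact: cvgMl_tmp.
  have := cvg_unique (@Rhausdorff R) H H0.
  rewrite !mulr0 expR0 mulr1 => /(_ _) /eqP; rewrite oppr_eq0 => H1; exact/eqP/H1.
move=> x x0; have /eqP := wE x x0; rewrite a1 b1 !mul0r subr0.
by rewrite mulf_eq0 mulf_eq0 pnatr_eq0 (gt_eqF k0)/= => /eqP.
Unshelve. all: by end_near. Qed.

(** * Comparison and convergence *)

Lemma lipschitz_continuous (R : realType) (L : R) (G : R -> R) : 0 <= L ->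
  (forall v w, `|G v - G w| <= L * `|v - w|) -> continuous G.
Proof.
move=> L0 G_lip.
move=> v; apply/cvgrPdist_le => e e0.
have L1 : 0 < L + 1 by rewrite ltr_wpDl.
exists (e / (L + 1)) => /=; first by rewrite divr_gt0.
move=> w /= vw; rewrite (le_trans (G_lip _ _))//.
rewrite (le_trans (ler_wpM2l L0 (ltW vw)))// mulrCA ler_piMr ?(ltW e0)//.
by rewrite ler_pdivrMr// mul1r lerDl.
Qed.

Section compare.
Variable R : realType.
Variables zeta gamma L : R.
Variable G : R -> R.
Hypotheses (zeta0 : 0 < zeta) (gamma1 : 1 < gamma) (L0 : 0 <= L).
Hypothesis G_homo : {homo G : v w / v <= w}.
Hypothesis G_odd : forall v, G (- v) = - G v.
Hypothesis G_le1 : forall v, `|G v| <= 1.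
Hypothesis G_lip : forall v w, `|G v - G w| <= L * `|v - w|.
Notation mu := (@lebesgue_measure R).
Notation RR := (measurableTypeR R * measurableTypeR R)%type.
Notation Ex := (@Ex R zeta).

Lemma measurable_G : measurable_fun setT G.
Proof. exact: nondecreasing_measurable. Qed.

(** The nonlinear Duhamel term at time [t], as a function of the branching time and position. *)
Definition delay (a : R -> R -> R) (t : R) : RR -> R :=
  fun z => G (a (t - z.1) (gamma^-1 * z.2)).

Lemma bmeas_delay (a : R -> R -> R) (t : R) :
  measurable_fun setT (fun z : RR => a z.1 z.2) -> bounded_measurable (delay a t).
Proof.
move=> ma; split; last by exists 1 => z; exact: G_le1.
apply: (measurableT_comp measurable_G).
have m1 : @measurable_fun _ _ RR (measurableTypeR R) setT (fun z => t - z.1).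
  by apply: measurable_funB => //; exact: measurable_fst.
have m2 : @measurable_fun _ _ RR (measurableTypeR R) setT (fun z => gamma^-1 * z.2).
  by apply: measurable_funM => //; exact: measurable_snd.
have mp : @measurable_fun _ _ RR RR setT (fun z => (t - z.1, gamma^-1 * z.2)).
  by apply/measurable_fun_pairP; split.
exact: (measurableT_comp ma mp).
Qed.

Lemma bmeas_space (V : R -> R) : measurable_fun setT V ->
  bounded_measurable (fun z : RR => G (V (gamma^-1 * z.2))).
Proof.
move=> mV; split; last by exists 1 => z; exact: G_le1.
apply: (measurableT_comp measurable_G); apply: (measurableT_comp mV).
have m2 : @measurable_fun _ _ RR (measurableTypeR R) setT (fun z => gamma^-1 * z.2).
  by apply: measurable_funM => //; exact: measurable_snd.
exact: m2.
Qed.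

Let lam := 2 * L * zeta.

Let lam0 : 0 <= lam. Proof. by rewrite !mulr_ge0// ltW. Qed.

(** The expected weight [zeta / (zeta + lam)] must absorb the Lipschitz constant [L];
    [lam = 2 L zeta] suffices because [L zeta <= (zeta + lam) / 2]. *)
Let contraction : L * (zeta / (zeta + lam)) <= 2^-1.
Proof.
have z1 : 0 < zeta + lam by rewrite ltr_wpDr.
rewrite mulrA ler_pdivrMr// /lam mulrDr !mulrA mulVf ?pnatr_eq0// mul1r.
by rewrite lerDr mulr_ge0// ltW.
Qed.

(* Gronwall's inequality in the weighted norm sup e^(-lam t) D, with lam so
   large that one pass through the Duhamel formula halves this norm. *)
Lemma weighted_gronwall (D : R -> R -> R) (P : R -> Prop) (M : R) :
  (forall t x, 0 < t -> P x -> D t x <= M) ->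
  (forall C, 0 <= C -> (forall t x, 0 < t -> P x -> D t x <= C * expR (lam * t)) ->
    forall t x, 0 < t -> P x ->
      D t x <= Ex x (fun z => L * C * (expR (lam * t) * expR (- (lam * `|z.1|))))) ->
  forall t x, 0 < t -> P x -> D t x <= 0.
Proof.
move=> DM Dstep.
have H (n : nat) t x : 0 < t -> P x -> D t x <= `|M| / 2 ^+ n * expR (lam * t).
  elim: n t x => [|n IH] t x t0 Px.
    rewrite expr0 divr1 (le_trans (DM t x t0 Px))// (le_trans (ler_norm _))// ler_peMr//.
    by rewrite -expR0 ler_expR mulr_ge0// ltW.
  have C0 : 0 <= `|M| / 2 ^+ n by rewrite divr_ge0.
  apply: le_trans (Dstep _ C0 IH t x t0 Px) _.
  have be := bmeas_exp lam0.
  under [X in Ex x X]eq_fun do rewrite mulrA.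
  rewrite (ExZ zeta0)// Ex_exp//.
  rewrite [leLHS](_ : _ = (`|M| / 2 ^+ n * expR (lam * t)) * (L * (zeta / (zeta + lam)))); last by ring.
  rewrite [leRHS](_ : _ = (`|M| / 2 ^+ n * expR (lam * t)) * 2^-1); last by rewrite exprSr invfM; ring.
  apply: ler_wpM2l; last exact: contraction.
  by rewrite mulr_ge0 ?expR_ge0.
move=> t x t0 Px; have {}H n := H n t x t0 Px.
rewrite leNgt; apply/negP => D0.
pose K := `|M| * expR (lam * t).
have K0 : 0 <= K by rewrite mulr_ge0 ?expR_ge0.
have := H (Num.truncn (K / D t x)).+1.
rewrite mulrAC ler_pdivlMr ?exprn_gt0//; apply/negP; rewrite -ltNge -/K.
have : K / D t x < 2 ^+ (Num.truncn (K / D t x)).+1.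
  apply: lt_trans (truncnS_gt _) _.
  by rewrite -natrX ltr_nat ltn_expl.
by rewrite ltr_pdivrMr// mulrC.
Qed.

(** Only an integral inequality on [x >= 0] is available, while the expectation sees the whole line.
    Oddness makes [le_Ex_odd] applicable, so the integrands need to be compared only at [y > 0]. *)
Lemma compare (a b : R -> R -> R) (M : R) :
  measurable_fun setT (fun z : RR => a z.1 z.2) ->
  measurable_fun setT (fun z : RR => b z.1 z.2) ->
  (forall t x, t <= 0 -> a t x = 0) -> (forall t x, t <= 0 -> b t x = 0) ->
  (forall t x, a t (- x) = - a t x) -> (forall t x, b t (- x) = - b t x) ->
  (forall t x, a t x - b t x <= M) ->
  (forall t x, 0 < t -> 0 <= x ->
     a t x - b t x <= Ex x (fun z => delay a t z - delay b t z)) ->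
  forall t x, 0 < t -> 0 <= x -> a t x <= b t x.
Proof.
move=> ma mb a0 b0 aodd bodd abM ab t x t0 x0; rewrite -subr_le0.
apply: (@weighted_gronwall (fun t x => a t x - b t x) (fun x => 0 <= x) M) => //.
move=> C C0 DC {}t {}x {}t0 {}x0; apply: le_trans (ab t x t0 x0) _.
have bd : bounded_measurable (fun z => delay a t z - delay b t z) by apply: bmeasB; exact: bmeas_delay.
pose e z := L * C * (expR (lam * t) * expR (- (lam * `|(z : RR).1|))).
have be : bounded_measurable e.
  by apply: bmeasM; [exact: bmeas_cst|apply: bmeasM; [exact: bmeas_cst|exact: bmeas_exp]].
have e0 z : 0 <= e z by rewrite !mulr_ge0 ?expR_ge0.
(* The Gronwall bound [e] is even in space; its odd version [e * sgn(y)] is what [le_Ex_odd] can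
   compare with, and it lies below [e]. *)
apply: (@le_trans _ _ (Ex x (fun z => e z * Num.sg z.2))); last first.
  apply: le_Ex => //; first by apply: bmeasM => //; exact: bmeas_sg.
  move=> s y s0; rewrite ler_piMr//=.
  by case: sgrP => _; lra.
apply: le_Ex_odd => //; first by apply: bmeasM => //; exact: bmeas_sg.
  move=> s y s0; rewrite /delay /e/= sgrN !mulrN aodd bodd !G_odd; ring.
move=> s y s0 y0; rewrite gtr0_sg//= mulr1 /delay/=.
have [ts|st] := leP t s.
  by rewrite a0 ?b0 ?subr_le0// subrr; exact: e0.
have y'0 : 0 <= gamma^-1 * y by rewrite mulr_ge0 ?invr_ge0 ?ltW// (lt_trans ltr01).
have := DC (t - s) (gamma^-1 * y); rewrite subr_gt0 => /(_ st y'0).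
move: (a (t - s) _) (b (t - s) _) => v w vw.
(* If [v <= w], monotonicity of [G] already gives a nonpositive difference; the Lipschitz bound is
   needed only when [v - w] is positive and thus controlled by the one-sided estimate. *)
have [vw'|wv] := leP v w.
  by rewrite (le_trans _ (e0 _))// subr_le0 G_homo.
rewrite (le_trans (ler_norm _))// (le_trans (G_lip _ _))// gtr0_norm ?subr_gt0//.
rewrite /e -mulrA ler_wpM2l// (le_trans vw)//= -expRD ler_wpM2l// ler_expR.
by rewrite (gtr0_norm s0) mulrBr.
Qed.

End compare.

(** * The mild solution: Duhamel's formula, oddness, monotonicity in time *)

Section mild.
Variable R : realType.
Variables zeta gamma L : R.
Variables F G : R -> R.
Variable u : R -> R -> R.
Hypotheses (zeta0 : 0 < zeta) (gamma1 : 1 < gamma) (L0 : 0 <= L).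
Hypothesis G_homo : {homo G : v w / v <= w}.
Hypothesis G_odd : forall v, G (- v) = - G v.
Hypothesis G_le1 : forall v, `|G v| <= 1.
Hypothesis G_lip : forall v w, `|G v - G w| <= L * `|v - w|.
Hypothesis FG : forall v, -1 <= v <= 1 -> F v = G v.
Hypothesis u_sol : mild_solution gamma zeta F u.
Notation mu := (@lebesgue_measure R).
Notation RR := (measurableTypeR R * measurableTypeR R)%type.
Notation Ex := (@Ex R zeta).

(* With the value 0 at negative times, the term G(u(t - s, y / gamma)) vanishes
   for s >= t, so that the Duhamel integral needs no restriction to s < t. *)
Definition upos (t x : R) : R := if 0 < t then u t x else 0.

Lemma normr_upos t x : `|upos t x| <= 1.
Proof.
rewrite /upos; case: ifPn => [t0|]; last by rewrite normr0.
by have [H _ _] := u_sol; rewrite ler_norml H// ltW.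
Qed.

Lemma measurable_upos : measurable_fun setT (fun z : RR => upos z.1 z.2).
Proof.
have [_ mu0 _] := u_sol.
have m1 : @measurable_fun _ _ RR (measurableTypeR R) setT fst by exact: measurable_fst.
have mP : measurable_fun setT (fun z : RR => 0 < z.1) by exact: measurable_fun_ltr.
apply: measurable_fun_if => //.
have mD : measurable [set z : RR | 0 <= z.1].
  have mb : measurable_fun setT (fun z : RR => 0 <= z.1) by exact: measurable_fun_ler.
  have := mb measurableT [set true] Logic.I.
  by rewrite setTI.
apply: (measurable_funS mD); last exact: mu0.
by move=> z /= [_ z0]; exact: ltW.
Qed.

Let d0 := @bmeas_delay R gamma G G_homo G_le1 upos.

Let G0 : G 0 = 0.
Proof.
by have /eqP := G_odd 0; rewrite oppr0 -addr_eq0 -mulr2n mulrn_eq0/= => /eqP.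
Qed.

(** Fubini and the time reversal [s -> t - s] turn the Duhamel integral into an expectation over the
    branching time. *)
Lemma mildE (t x : R) : 0 < t ->
  u t x = expR (- (zeta * t)) * heat_sg t x + Ex x (delay gamma G upos t).
Proof.
move=> t0; have [ub _ /(_ t x (ltW t0)) ->] := u_sol.
congr (_ + _).
  by rewrite /killed_heat gt_eqF// Rintegral_normal_pdf_sg.
have bd := d0 t measurable_upos.
have ik := integrable_ker zeta0 x bd.
pose f z := (killed_kernel zeta x z * delay gamma G upos t z)%:E.
pose FF := fubini_F mu f.
have mFF : measurable_fun setT FF by exact: (measurable_fubini_F ik).
have iFF : mu.-integrable setT FF by exact: (integrable_fubini_F ik).
have E : Ex x (delay gamma G upos t) = fine (\int[mu]_s FF (t - s)%R)%E.
  rewrite /Ex /Rintegral -(integral12_prod_meas1 ik); congr fine.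
  exact: esym (integral_reflect t mFF).
rewrite E.
(* For [s >= t] the kernel vanishes, for [s <= 0] the value [upos = 0] and [G 0 = 0] do. *)
have FF0 s : s \notin `]0, t[ -> FF (t - s) = 0%E.
  rewrite in_itv/= negb_and -!leNgt => s0t; apply: integral0_eq => y _.
  rewrite /f /killed_kernel/=; case: ifPn; rewrite ?mul0r// subr_gt0 => st.
  move: s0t => /orP[s0|]; last by rewrite leNgt st.
  rewrite /delay/=.
  by rewrite opprB addrCA subrr addr0 /upos ltNge s0 /= G0 mulr0.
have mkc : (\int[mu]_s FF (t - s)%R = \int[mu]_(s in `]0%R, t[) FF (t - s)%R)%E.
  rewrite [RHS]integral_mkcond; apply: eq_integral => s _; rewrite patchE mem_setE.
  by case: ifPn => // /FF0.
rewrite mkc.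
have mr : measurable_fun setT (fun s : measurableTypeR R => FF (t - s)).
  by apply: (measurableT_comp mFF); exact: measurable_reflect.
pose kh s := killed_heat zeta (t - s) (fun y => F (u s (gamma^-1 * y))) x.
have FFE s : s \in `]0, t[ -> FF (t - s) = (zeta * kh s)%:E.
  rewrite in_itv/= => /andP[s0 st].
  have ts : 0 < t - s by rewrite subr_gt0.
  rewrite /FF (@fubini_ker R zeta x _ _ bd ts) /kh /killed_heat gt_eqF// -mulrA.
  congr (_ * (_ * _))%:E; apply: eq_Rintegral => y _; congr (_ * _).
  rewrite /delay/= opprB addrCA subrr addr0 /upos s0 FG//.
  by apply: ub; exact: ltW.
have iFFr : mu.-integrable setT (fun s : measurableTypeR R => FF (t - s)).
  have /integrableP[_ iFF2] := iFF; apply/integrableP; split; first exact: mr.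
  have mFFa : measurable_fun setT (fun s => `|FF s|%E) by exact: measurableT_comp.
  by rewrite (@ge0_integral_reflect R t (fun s => `|FF s|%E) mFFa (fun s => abse_ge0 _)).
have ikh : mu.-integrable `]0%R, t[ (fun s => (zeta * kh s)%:E).
  have i1 : mu.-integrable `]0%R, t[ (fun s : measurableTypeR R => FF (t - s)).
    exact: integrableS iFFr.
  by apply: eq_integrable i1 => // s; rewrite inE/= => /FFE.
have ikh2 : mu.-integrable `]0%R, t[ (EFin \o kh).
  have := @integrableZl _ (measurableTypeR R) R mu `]0%R, t[%classic (measurable_itv _) zeta^-1 _ ikh.
  apply: eq_integrable => // s _; rewrite /= -EFinM mulKf ?gt_eqF//.
rewrite -/kh; transitivity (zeta * \int[mu]_(s in `]0%R, t[) kh s).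
  congr (_ * fine _).
  have mkh : measurable_fun `]0%R, t[ kh by apply/measurable_EFinP; exact: measurable_int ikh2.
  have mkh2 : measurable_fun `[0%R, t[ kh.
    by apply/measurable_fun_itv_obnd_cbndP.
  rewrite -integral_itv_bndo_bndc; last exact/measurable_EFinP.
  by rewrite -integral_itv_obnd_cbnd//; exact/measurable_EFinP.
rewrite -RintegralZl//; congr fine; apply: eq_integral => s; rewrite inE/= => /FFE ->.
by [].
Qed.

Lemma heat_sgN (t x : R) : 0 < t -> heat_sg t (- x) = - heat_sg t x.
Proof.
move=> t0; rewrite /heat_sg -!(Rintegral_normal_pdf_sg _ t0).
have isg := integrable_normal_pdf_sg (Num.sqrt t).
transitivity (\int[mu]_y (-1 * (normal_pdf x (Num.sqrt t) y * Num.sg y))); last first.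
  by rewrite (@RintegralZl _ (measurableTypeR R) R mu setT _ (-1) measurableT (isg x)) mulN1r.
rewrite /Rintegral -(integral_reflect 0 (measurable_int _ (isg (- x)))).
by congr fine; apply: eq_integral => y _; congr EFin; rewrite sub0r sgrN mulrN mulN1r normal_pdfNN.
Qed.

(** The initial terms at [x] and [- x] cancel, so the defect [|u t (- x) + u t x|] satisfies a
    homogeneous Gronwall inequality on the whole line; 2 is its trivial bound. *)
Lemma u_odd (t x : R) : 0 < t -> u t (- x) = - u t x.
Proof.
move=> t0; apply/eqP; rewrite -addr_eq0; apply/eqP.
suff H : forall t x, 0 < t -> True -> `|u t (- x) + u t x| <= 0.
  by have := H t x t0 I; rewrite normr_le0 => /eqP.
apply: (@weighted_gronwall R zeta L zeta0 L0 (fun t x => `|u t (- x) + u t x|) (fun=> True) 2).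
  move=> s y s0 _; have [ub _ _] := u_sol.
  have b1 : `|u s (- y)| <= 1 by rewrite ler_norml ub// ltW.
  have b2 : `|u s y| <= 1 by rewrite ler_norml ub// ltW.
  by rewrite (le_trans (ler_normD _ _))// (le_trans (lerD b1 b2)).
move=> C C0 HC {}t {}x {}t0 _.
rewrite (mildE (- x) t0) (mildE x t0) heat_sgN// mulrN addrACA addNr add0r.
have bd := d0 t measurable_upos.
rewrite (@Ex_reflect R zeta zeta0 (- x))// opprK.
have br := bmeas_reflect bd.
rewrite -(ExD zeta0)//.
have bs := bmeasD br bd.
apply: (le_trans (normr_Ex zeta0 x bs)).
apply: le_Ex => //.
- exact: bmeas_norm.
- apply: bmeasM; [exact: bmeas_cst|apply: bmeasM; [exact: bmeas_cst|]].
  by apply: bmeas_exp; rewrite !mulr_ge0// ltW.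
move=> s y s0; rewrite /delay/=.
rewrite -[G (upos (t - s) (gamma^-1 * y))]opprK -G_odd.
rewrite (le_trans (G_lip _ _))// -mulrA ler_wpM2l// opprK.
rewrite mulrN /upos subr_gt0; case: ifPn => st; last first.
  by rewrite addr0 normr0 !mulr_ge0 ?expR_ge0.
rewrite (le_trans (HC _ _ _ Logic.I)) ?subr_gt0//.
by rewrite ler_wpM2l// -expRD ler_expR (gtr0_norm s0) mulrBr.
Qed.

Lemma u_oddp (t x : R) : upos t (- x) = - upos t x.
Proof. by rewrite /upos; case: ifPn => [/u_odd ->//|_]; rewrite oppr0. Qed.

Lemma delay_odd (a : R -> R -> R) (t s y : R) : (forall t x, a t (- x) = - a t x) ->
  delay gamma G a t (s, - y) = - delay gamma G a t (s, y).
Proof. by move=> aodd; rewrite /delay/= mulrN aodd G_odd. Qed.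

(* The part of the Duhamel integral older than t is dominated by the
   contribution of the initial value. *)
Lemma Ex_tail_le (t x : R) (P : RR -> bool) (f : RR -> R) : 0 < t -> 0 <= x ->
  measurable_fun setT P -> (forall s y : R, 0 < s -> P (s, y) = P (s, 0)) ->
  (forall s y : R, P (s, y) -> t <= s) -> bounded_measurable f -> (forall z, `|f z| <= 1) ->
  (forall s y : R, 0 < s -> f (s, - y) = - f (s, y)) ->
  Ex x (fun z => (P z)%:R * f z) <= heat_sg t x * Ex x (fun z => (P z)%:R).
Proof.
move=> t0 x0 mP Py Pt bf f1 fodd; apply: Ex_tail => // s y s0 y0.
by rewrite (le_trans (ler_norm _)).
Qed.

(** The solution shifted by [h], cut off at nonpositive times, is compared with [u]. The cutoff
    removes from its Duhamel formula the branching times in [[s, s + h)], which are estimated by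
    [Ex_tail_le]. *)
Lemma u_noninc (t t' x : R) : 0 < t -> t <= t' -> 0 <= x -> u t' x <= u t x.
Proof.
move=> t0 tt' x0.
pose h := t' - t; have h0 : 0 <= h by rewrite subr_ge0.
pose a s y := if 0 < s then upos (s + h) y else 0.
suff : a t x <= upos t x.
  by rewrite /a /upos t0 /h addrC subrK (lt_le_trans t0 tt').
have m1 : @measurable_fun _ _ RR (measurableTypeR R) setT fst by exact: measurable_fst.
have ma : measurable_fun setT (fun z : RR => a z.1 z.2).
  have mh : @measurable_fun _ _ RR RR setT (fun z => (z.1 + h, z.2)).
    apply/measurable_fun_pairP; split; last exact: measurable_snd.
    exact: measurable_funD.
  apply: measurable_fun_ifT => //; first exact: measurable_fun_ltr.
  exact: (measurableT_comp measurable_upos mh).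
apply: (@compare R zeta gamma L G zeta0 gamma1 L0 G_homo G_odd G_le1 G_lip a upos 2) => //.
- exact: measurable_upos.
- by move=> s y s0; rewrite /a ltNge s0.
- by move=> s y s0; rewrite /upos ltNge s0.
- by move=> s y; rewrite /a u_oddp; case: ifP => //; rewrite oppr0.
- exact: u_oddp.
- move=> s y; have b1 := normr_upos (s + h) y; have b2 := normr_upos s y.
  rewrite (le_trans (ler_norm _))// (le_trans (ler_normB _ _))//.
  rewrite /a; case: ifP => _; rewrite ?normr0; lra.
move=> {tt' t0 x0}s y s0 y0.
have sh0 : 0 < s + h by rewrite ltr_wpDr.
rewrite /a s0 /upos s0 sh0 (mildE y s0) (mildE y sh0).
have b1 := d0 (s + h) measurable_upos; have b2 := d0 s measurable_upos.
have b3 : bounded_measurable (delay gamma G a s) by exact: bmeas_delay.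
pose P z := (s <= (z : RR).1) && (z.1 < s + h).
have mP : measurable_fun setT P.
  by apply: measurable_and; [exact: measurable_fun_ler|exact: measurable_fun_ltr].
have bP := bmeas_bool mP.
have E1 : Ex y (delay gamma G upos (s + h)) =
    Ex y (delay gamma G a s) + Ex y (fun z => (P z)%:R * delay gamma G upos (s + h) z).
  rewrite -(ExD zeta0)//; last exact: bmeasM.
  apply: eq_Ex => r z r0; rewrite /delay /a /P/= subr_gt0.
  have [sr|rs] := leP s r; last by rewrite mul0r addr0 addrAC.
  have [rsh|shr] := ltP r (s + h); first by rewrite G0 add0r mul1r.
  by rewrite /upos subr_gt0 ltNge shr/= G0 mul0r addr0.
have E2 : Ex y (fun z => (P z)%:R) = expR (- (zeta * s)) - expR (- (zeta * (s + h))).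
  rewrite -!(@Ex_ge R zeta zeta0 _ y)//; [|exact: ltW|exact: ltW].
  rewrite -(ExB zeta0); try exact: bmeas_ge.
  apply: eq_Ex => r z r0; rewrite /P/=.
  have [sr|rs] := leP s r; last by rewrite leNgt (lt_le_trans rs) ?lerDl// subrr.
  by case: ltP => _; rewrite ?subr0 ?subrr.
have T := @Ex_tail_le s y P _ s0 y0 mP _ _ b1 (fun z => G_le1 _) (fun r z _ => delay_odd _ _ _ u_oddp).
have {}T := T (fun _ _ _ => erefl) (fun _ _ H => proj1 (andP H)).
rewrite E2 in T; rewrite E1 (ExB zeta0)//.
have S1 := heat_sg_noninc y0 s0 (_ : s <= s + h); rewrite lerDl in S1.
have {}S1 := S1 h0.
have e0 := expR_ge0 (- (zeta * (s + h))).
(* With [p = e^(-zeta s)] and [q = e^(-zeta (s + h))], what remains is [q P_(s+h) sgn + (p - q) P_s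
   sgn <= p P_s sgn]. *)
have := ler_wpM2l e0 S1.
move: T.
move: (expR _) (expR _) (heat_sg _ _) (heat_sg _ _) (Ex _ _) (Ex _ _) (Ex _ _) => p q c d e f g.
by move=> T1 T2; lra.
Qed.

(** A stationary [V] has no initial term; its branching times beyond [s] contribute at most
    [e^(-zeta s) P_s sgn(y)], which is precisely the initial term of [u]. *)
Lemma u_le_of_resolvent (V : R -> R) : measurable_fun setT V ->
  (forall x, `|V x| <= 1) -> (forall x, V (- x) = - V x) ->
  (forall x : R, 0 <= x -> V x = Ex x (fun z => G (V (gamma^-1 * z.2)))) ->
  forall t x : R, 0 < t -> 0 <= x -> V x <= u t x.
Proof.
move=> mV V1 Vodd VE t x t0 x0.
pose a (s y : R) := if 0 < s then V y else 0.
suff : a t x <= upos t x by rewrite /a /upos t0.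
have m1 : @measurable_fun _ _ RR (measurableTypeR R) setT fst by exact: measurable_fst.
have ma : measurable_fun setT (fun z : RR => a z.1 z.2).
  apply: measurable_fun_ifT => //; first exact: measurable_fun_ltr.
  by apply: (measurableT_comp mV); exact: measurable_snd.
apply: (@compare R zeta gamma L G zeta0 gamma1 L0 G_homo G_odd G_le1 G_lip a upos 2) => //.
- exact: measurable_upos.
- by move=> s y s0; rewrite /a ltNge s0.
- by move=> s y s0; rewrite /upos ltNge s0.
- by move=> s y; rewrite /a Vodd; case: ifP => //; rewrite oppr0.
- exact: u_oddp.
- move=> s y; have b1 := V1 y; have b2 := normr_upos s y.
  rewrite (le_trans (ler_norm _))// (le_trans (ler_normB _ _))//.
  rewrite /a; case: ifP => _; rewrite ?normr0; lra.
move=> {t x t0 x0}s y s0 y0.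
rewrite /a s0 /upos s0 (mildE y s0) (VE _ y0).
have b2 := d0 s measurable_upos.
have b3 : bounded_measurable (delay gamma G a s) by exact: bmeas_delay.
pose g z := G (V (gamma^-1 * (z : RR).2)).
have bg : bounded_measurable g by exact: (bmeas_space gamma G_homo G_le1 mV).
pose P z := s <= (z : RR).1.
have mP : measurable_fun setT P by exact: measurable_fun_ler.
have bP := bmeas_bool mP.
have E1 : Ex y g = Ex y (delay gamma G a s) + Ex y (fun z => (P z)%:R * g z).
  rewrite -(ExD zeta0)//; last exact: bmeasM.
  apply: eq_Ex => r z r0; rewrite /delay /a /P /g/= subr_gt0.
  by have [sr|rs] := leP s r; rewrite ?mul0r ?addr0// G0 add0r mul1r.
have T := @Ex_tail_le s y P g s0 y0 mP _ _ bg (fun z => G_le1 _).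
have {}T := T (fun _ _ _ => erefl) (fun _ _ H => H).
rewrite (@Ex_ge R zeta zeta0 s y (ltW s0)) in T.
have {}T := T _; rewrite -/g E1 (ExB zeta0)//.
have godd (r z : R) : 0 < r -> g (r, - z) = - g (r, z).
  by move=> _; rewrite /g/= mulrN Vodd G_odd.
have {T} := T godd.
move: (expR _) (heat_sg _ _) (Ex _ _) (Ex _ _) (Ex _ _) => p q c d e T.
by lra.
Qed.

(** * The limit for large times and the elliptic problem *)

Definition Uinf (x : R) : R := lim (u t x @[t --> +oo]).

Let u_cvg_pos (x : R) : 0 <= x -> cvg (u t x @[t --> +oo]).
Proof.
move=> x0; have [ub _ _] := u_sol.
(* Monotonicity is known for positive times only; [Num.max t 1] makes the function monotone on all
   of [R] without changing it for large [t]. *)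
have H : - u (Num.max t 1) x @[t --> +oo] --> sup (range (fun t => - u (Num.max t 1) x)).
  apply: nondecreasing_cvgr.
    move=> s t st; rewrite lerN2 u_noninc//.
      by rewrite lt_max ltr01 orbT.
    by rewrite ge_max !le_max st lexx /= orbT.
  exists 1 => _ [t _ <-].
  have t1 : 0 <= Num.max t 1 by rewrite le_max ler01 orbT.
  by have /andP[h _] := ub _ x t1; rewrite lerNl.
apply/cvg_ex; exists (- sup (range (fun t => - u (Num.max t 1) x))).
have : - - u (Num.max t 1) x @[t --> +oo] -->
    - sup (range (fun t => - u (Num.max t 1) x)) by exact: cvgN.
apply: cvg_trans; apply: near_eq_cvg; near=> t.
rewrite opprK max_l//; near: t; apply: nbhs_pinfty_ge; rewrite num_real.
Unshelve. all: by end_near. Qed.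

Lemma u_cvg (x : R) : u t x @[t --> +oo] --> Uinf x.
Proof.
suff : cvg (u t x @[t --> +oo]) by [].
have [x0|x0] := leP 0 x; first exact: u_cvg_pos.
have /cvg_ex[l Hl] : cvg (u t (- x) @[t --> +oo]) by apply: u_cvg_pos; rewrite oppr_ge0 ltW.
apply/cvg_ex; exists (- l); have : - u t (- x) @[t --> +oo] --> - l by exact: cvgN.
apply: cvg_trans; apply: near_eq_cvg; near=> t.
by rewrite u_odd ?opprK//; near: t; apply: nbhs_pinfty_gt; rewrite num_real.
Unshelve. all: by end_near. Qed.

Lemma Uinf_odd (x : R) : Uinf (- x) = - Uinf x.
Proof.
apply/cvg_lim => //; have : - u t x @[t --> +oo] --> - Uinf x by apply: cvgN; exact: u_cvg.
apply: cvg_trans; apply: near_eq_cvg; near=> t.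
by rewrite u_odd//; near: t; apply: nbhs_pinfty_gt; rewrite num_real.
Unshelve. all: by end_near. Qed.

Lemma Uinf_bnd (x : R) : -1 <= Uinf x <= 1.
Proof.
have [ub _ _] := u_sol.
have cu : cvg (u t x @[t --> +oo]) by apply/cvg_ex; exists (Uinf x); exact: u_cvg.
by apply/andP; split; [apply: limr_ge => //|apply: limr_le => //]; near=> t;
  have /andP[] : -1 <= u t x <= 1 by apply: ub; near: t; apply: nbhs_pinfty_ge; rewrite num_real.
Unshelve. all: by end_near. Qed.

Lemma le_Uinf (V : R) (x : R) : (forall t, 0 < t -> V <= u t x) -> V <= Uinf x.
Proof.
move=> Vu; apply: limr_ge; first by apply/cvg_ex; exists (Uinf x); exact: u_cvg.
by near=> t; apply: Vu; near: t; apply: nbhs_pinfty_gt; rewrite num_real.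
Unshelve. all: by end_near. Qed.

Lemma cvg_upos_nat (s x : R) : upos (n%:R - s) x @[n --> \oo] --> Uinf x.
Proof.
have H : (n%:R - s : R) @[n --> \oo] --> +oo.
  apply: (@cvg_comp _ _ _ (fun n => n%:R) (fun r => r - s) _ +oo); first exact: cvgr_idn.
  exact: cvg_addrr.
have := cvg_comp _ _ H (@u_cvg x).
apply: cvg_trans; apply: near_eq_cvg; near=> n.
rewrite /upos /= ifT//; near: n.
by have /cvgryPgt := H; apply.
Unshelve. all: by end_near. Qed.

Lemma measurable_Uinf : measurable_fun setT Uinf.
Proof.
apply: (@measurable_fun_cvg _ _ _ _ (fun n => upos n%:R)) => //.
  move=> n.
  have mp : @measurable_fun _ _ (measurableTypeR R) RR setT (fun x => (n%:R, x)).
    by apply/measurable_fun_pairP; split; [exact: measurable_cst|exact: measurable_id].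
  exact: (measurableT_comp measurable_upos mp).
by move=> x _; have := @cvg_upos_nat 0 x; under eq_fun do rewrite subr0.
Qed.

(** Passage to the limit in [mildE] along integer times: the initial term decays like [e^(-zeta n)],
    and the kernel itself dominates the integrands since [|G| <= 1]. *)
Lemma UinfE (x : R) : 0 <= x -> Uinf x = Ex x (fun z => G (Uinf (gamma^-1 * z.2))).
Proof.
move=> x0.
pose g z := G (Uinf (gamma^-1 * (z : RR).2)).
have bg : bounded_measurable g by exact: (bmeas_space gamma G_homo G_le1 measurable_Uinf).
have mk n : measurable_fun setT (fun z => (killed_kernel zeta x z * delay gamma G upos n%:R z)%:E).
  apply/measurable_EFinP; apply: measurable_funM; first exact: measurable_ker.
  by have [] := d0 n%:R measurable_upos.
have mg : measurable_fun setT (fun z => (killed_kernel zeta x z * g z)%:E).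
  apply/measurable_EFinP; apply: measurable_funM; first exact: measurable_ker.
  by have [] := bg.
have cpt : {ae (mu \x mu)%E, forall z, setT z ->
    (killed_kernel zeta x z * delay gamma G upos n%:R z)%:E @[n --> \oo] --> (killed_kernel zeta x z * g z)%:E}.
  apply: aeW => z _; apply: cvg_EFin; first exact: nearW.
  apply: cvgMl_tmp; apply: (cvg_comp _ _ (@cvg_upos_nat z.1 (gamma^-1 * z.2))).
  exact: (lipschitz_continuous L0 G_lip).
have dom : {ae (mu \x mu)%E, forall z, forall n, setT z ->
    (`|(killed_kernel zeta x z * delay gamma G upos n%:R z)%:E| <= (killed_kernel zeta x z * 1)%:E)%E}.
  apply: aeW => z n _; rewrite abse_EFin lee_fin normrM ger0_norm ?ker_ge0//.
  by apply: ler_wpM2l; [exact: ker_ge0|exact: G_le1].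
have [ig _ cI] := dominated_convergence measurableT mk mg cpt
  (integrable_ker zeta0 x (bmeas_cst 1)) dom.
have cE : Ex x (delay gamma G upos n%:R) @[n --> \oo] --> Ex x g.
  apply: fine_cvg; rewrite fineK; first exact: cI.
  exact: integrable_fin_num.
have cS : expR (- (zeta * n%:R)) * heat_sg n%:R x @[n --> \oo] --> (0 : R).
  have ce : expR (- (zeta * n%:R)) @[n --> \oo] --> (0 : R).
    apply: (@cvg_comp _ _ _ (fun n => n%:R) (fun s => expR (- (zeta * s))) _ +oo); first exact: cvgr_idn.
    apply: (@cvg_comp _ _ _ (fun s => zeta * s) (fun s => expR (- s))); last exact: cvgr_expR.
    exact: gt0_cvgMry.
  have ceN : - expR (- (zeta * n%:R)) @[n --> \oo] --> (0 : R).
    by rewrite -[X in _ --> X]oppr0; exact: cvgN.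
  apply: (squeeze_cvgr _ ceN ce); near=> n.
  have n0 : 0 < n%:R :> R by rewrite ltr0n; near: n; exact: nbhs_infty_gt.
  have h1 := heat_sg_le1 n%:R x; have := heat_sg_le1 n%:R (- x).
  rewrite heat_sgN// lerNl => h2.
  rewrite -[X in X <= _]mulrN1 ler_wpM2l ?expR_ge0//=.
  by rewrite ler_piMr// expR_ge0.
have H1 : u n%:R x @[n --> \oo] --> 0 + Ex x g.
  have : expR (- (zeta * n%:R)) * heat_sg n%:R x + Ex x (delay gamma G upos n%:R)
      @[n --> \oo] --> 0 + Ex x g by exact: cvgD.
  apply: cvg_trans; apply: near_eq_cvg; near=> n.
  by rewrite mildE// ltr0n; near: n; exact: nbhs_infty_gt.
have H2 : u n%:R x @[n --> \oo] --> Uinf x.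
  exact: (@cvg_comp _ _ _ (fun n => n%:R) (fun t => u t x) _ +oo _ (@cvgr_idn R) (@u_cvg x)).
by rewrite -[RHS]add0r; exact: (cvg_unique (@Rhausdorff R) H2 H1).
Unshelve. all: by end_near. Qed.

Let k := Num.sqrt (2 * zeta).

Let k0 : 0 < k. Proof. by rewrite sqrtr_gt0 mulr_gt0. Qed.

Let kz : zeta = k ^+ 2 / 2.
Proof. by rewrite sqr_sqrtr ?mulr_ge0 ?ltW// mulrC mulKf. Qed.

Let gamma_inv_gt0 (x : R) : 0 < x -> 0 < gamma^-1 * x.
Proof. by move=> x0; rewrite mulr_gt0// invr_gt0 (lt_trans ltr01). Qed.

(** Regularity is bootstrapped: [U] agrees on [[0, +oo)] with the resolvent of [g], so it is
    continuous, so [g] is continuous at positive points, so the resolvent is twice differentiable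
    there with [U'' = 2 zeta (U - g)]. *)
Lemma Uinf_elliptic :
  elliptic_solution gamma zeta F (fun x => if 0 < x then Uinf x else 0).
Proof.
set U := fun x => _.
pose g (y : R) := G (Uinf (gamma^-1 * y)).
have bg : bounded_measurable (fun z : RR => g z.2) by exact: (bmeas_space gamma G_homo G_le1 measurable_Uinf).
have U0 : Uinf 0 = 0.
  by have /eqP := Uinf_odd 0; rewrite oppr0 -addr_eq0 -mulr2n mulrn_eq0/= => /eqP.
have UE (x : R) : 0 <= x -> U x = resolvent_formula zeta k g x.
  move=> x0; rewrite -(Ex_resolvent_formula k0 kz bg x0) -UinfE// /U.
  by move: x0; rewrite le_eqVlt => /predU1P[<-|->//]; rewrite ltxx U0.
have [qc1 qc0] := (continuous_within_itvcyP 0 (resolvent_formula zeta k g)).1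
  (resolvent_formula_continuous bg).
have nearU (x : R) : 0 < x -> \forall y \near x, resolvent_formula zeta k g y = U y.
  by move=> x0; near=> y; rewrite UE// ltW//; near: y; exact: lt_nbhsr.
have Uc (x : R) : 0 < x -> {for x, continuous U}.
  move=> x0; suff : U y @[y --> x] --> U x by [].
  rewrite UE ?(ltW x0)//.
  have : resolvent_formula zeta k g y @[y --> x] --> resolvent_formula zeta k g x.
    by apply: qc1; rewrite in_itv/= andbT.
  apply: cvg_trans; apply: near_eq_cvg.
  by apply: filterS (nearU x x0) => y.
have gc (x : R) : 0 < x -> {for x, continuous g}.
  move=> x0; have x'0 := gamma_inv_gt0 x0.
  apply: (@continuous_comp _ _ _ (fun y => Uinf (gamma^-1 * y)) G); last exact: (lipschitz_continuous L0 G_lip).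
  apply: (@continuous_comp _ _ _ (fun y => gamma^-1 * y) Uinf).
    by apply: cvgMl_tmp; exact: cvg_id.
  suff : Uinf y @[y --> gamma^-1 * x] --> Uinf (gamma^-1 * x) by [].
  have : U y @[y --> gamma^-1 * x] --> Uinf (gamma^-1 * x).
    have -> : Uinf (gamma^-1 * x) = U (gamma^-1 * x) by rewrite /U x'0.
    exact: Uc.
  apply: cvg_trans; apply: near_eq_cvg; near=> y.
  by rewrite /U ifT//; near: y; exact: lt_nbhsr.
have dU (x : R) : 0 < x -> is_derive x 1 U (resolvent_slope zeta k g x).
  move=> x0; apply: near_eq_is_derive (resolvent_formula_is_derive zeta k bg x0 (gc x x0)).
  exact: nearU.
have nearU1 (x : R) : 0 < x -> \forall y \near x, resolvent_slope zeta k g y = U^`()%classic y.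
  move=> x0; near=> y; have y0 : 0 < y by near: y; exact: lt_nbhsr.
  by rewrite derive1E; have [_ ->] := dU y y0.
have d2U (x : R) : 0 < x -> is_derive x 1 U^`()%classic (2 * zeta * (resolvent_formula zeta k g x - g x)).
  move=> x0; apply: near_eq_is_derive (resolvent_slope_is_derive k0 kz bg x0 (gc x x0)).
  exact: nearU1.
have U2 (x : R) : 0 < x -> U^`(2)%classic x = 2 * zeta * (resolvent_formula zeta k g x - g x).
  by move=> x0; rewrite derive1nS derive1E /= ; have [_ ->] := d2U x x0.
have Ub (x : R) : -1 <= U x <= 1.
  by rewrite /U; case: ifPn => _; [exact: Uinf_bnd|rewrite lerN10 ler01].
split.
- apply/continuous_within_itvcyP; split => [x|].
    by rewrite in_itv/= andbT => /Uc.
  rewrite UE//; move: qc0; apply: cvg_trans; apply: near_eq_cvg.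
  by near=> y; rewrite UE//.
- move=> x x0; split.
  + by have [] := dU x x0.
  + by have [] := d2U x x0.
  + suff : U^`(2)%classic y @[y --> x] --> U^`(2)%classic x by [].
    rewrite U2//; have : 2 * zeta * (resolvent_formula zeta k g y - g y) @[y --> x] -->
        2 * zeta * (resolvent_formula zeta k g x - g x).
      apply: cvgMl_tmp; apply: cvgB; last exact: gc.
      by apply: qc1; rewrite in_itv/= andbT.
    apply: cvg_trans; apply: near_eq_cvg; near=> y.
    by rewrite U2//; near: y; exact: lt_nbhsr.
- by move=> x _; exact: Ub.
- by rewrite /U ltxx.
- move=> x x0; rewrite U2// (UE x (ltW x0)) FG//.
  have -> : G (U (gamma^-1 * x)) = g x by rewrite /g /U gamma_inv_gt0.
  by field.
Unshelve. all: by end_near. Qed.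

(** The odd extension [W] of [V] has a resolvent [q] solving the same linear equation with the same
    source and boundary value. The bounded difference [V - q] vanishes by [bounded_ode_zero], so [V]
    has the integral form required by [u_le_of_resolvent]. *)
Lemma elliptic_le_Uinf (V : R -> R) : elliptic_solution gamma zeta F V ->
  forall x : R, 0 < x -> V x <= Uinf x.
Proof.
move=> [cV dV Vb V0 Veq].
pose W (x : R) := Num.sg x * V `|x|.
have WE (x : R) : 0 <= x -> W x = V x.
  by rewrite le_eqVlt => /predU1P[<-|x0]; rewrite /W ?sgr0 ?mul0r// gtr0_sg// mul1r gtr0_norm.
have W1 (x : R) : `|W x| <= 1.
  rewrite normrM (@le_trans _ _ (1 * `|V `|x| |))//.
    by rewrite ler_wpM2r// normr_sg; case: (_ != 0).
  by rewrite mul1r ler_norml Vb.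
have Wodd (x : R) : W (- x) = - W x by rewrite /W sgrN normrN mulNr.
have mW : measurable_fun setT W.
  apply: measurable_funM; first exact: measurable_sg.
  apply: (@measurable_comp _ _ _ (measurableTypeR R) (measurableTypeR R) (measurableTypeR R)
    `[0, +oo[%classic V setT (@Num.norm R R)).
  - exact: measurable_itv.
  - by move=> _ [x _ <-] /=; rewrite in_itv/= andbT.
  - exact: subspace_continuous_measurable_fun.
  - exact: normr_measurable.
pose g (y : R) := G (W (gamma^-1 * y)).
have bg : bounded_measurable (fun z : RR => g z.2) by exact: (bmeas_space gamma G_homo G_le1 mW).
have [Vc Vc0] := (continuous_within_itvcyP 0 V).1 cV.
have gc (x : R) : 0 < x -> {for x, continuous g}.
  move=> x0; have x'0 := gamma_inv_gt0 x0.
  apply: (@continuous_comp _ _ _ (fun y => W (gamma^-1 * y)) G); last exact: (lipschitz_continuous L0 G_lip).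
  apply: (@continuous_comp _ _ _ (fun y => gamma^-1 * y) W).
    by apply: cvgMl_tmp; exact: cvg_id.
  suff : W y @[y --> gamma^-1 * x] --> W (gamma^-1 * x) by [].
  rewrite (WE _ (ltW x'0)).
  have : V y @[y --> gamma^-1 * x] --> V (gamma^-1 * x).
    by apply: Vc; rewrite in_itv/= andbT.
  apply: cvg_trans; apply: near_eq_cvg; near=> y.
  by rewrite WE// ltW//; near: y; exact: lt_nbhsr.
(* Symmetry of Brownian motion started at 0 gives the boundary value [q 0 = 0]. *)
have godd : Ex 0 (fun z => g z.2) = 0.
  have E : Ex 0 (fun z => g (- z.2)) = Ex 0 (fun z => -1 * g z.2).
    by apply: eq_Ex => s y s0 /=; rewrite mulN1r /g mulrN Wodd G_odd.
  have := Ex_reflect zeta0 0 bg; rewrite oppr0 /= E.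
  by rewrite (ExZ zeta0)// mulN1r => /eqP; rewrite -addr_eq0 -mulr2n mulrn_eq0/= => /eqP.
pose q := resolvent_formula zeta k g.
have qE (x : R) : 0 <= x -> Ex x (fun z => g z.2) = q x by move=> x0; exact: Ex_resolvent_formula.
have q1 (x : R) : 0 <= x -> `|q x| <= 1.
  move=> x0; rewrite -qE//; apply: le_trans (normr_Ex zeta0 x bg) _.
  have <- : Ex x (fun z : RR => (0 <= z.1)%R%:R) = 1.
    by rewrite (Ex_ge zeta0 x (lexx 0)) mulr0 oppr0 expR0.
  apply: le_Ex => //; [exact: bmeas_norm|exact: bmeas_ge|].
  by move=> s y s0 /=; rewrite (ltW s0); exact: G_le1.
have [qc1 qc0] := (continuous_within_itvcyP 0 q).1 (resolvent_formula_continuous bg).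
have Vq (x : R) : 0 < x -> V x - q x = 0.
  apply: (@bounded_ode_zero R k 2 (fun x => V x - q x)
    (fun x => V^`()%classic x - resolvent_slope zeta k g x)) => //.
  - move=> y y0; have h1 := resolvent_formula_is_derive zeta k bg y0 (gc y y0).
    have [dVy _ _] := dV y y0.
    have h2 : is_derive y 1 V (V^`()%classic y) by apply: DeriveDef; [exact: dVy|rewrite derive1E].
    exact: is_deriveB.
  - move=> y y0; have h1 := resolvent_slope_is_derive k0 kz bg y0 (gc y y0).
    have [_ dVy _] := dV y y0.
    have h2 : is_derive y 1 V^`()%classic (V^`(2)%classic y).
      by apply: DeriveDef; [exact: dVy|rewrite -derive1E].
    have := is_deriveB h2 h1; move/is_derive_eq; apply.
    have := Veq y y0; rewrite FG ?Vb ?(ltW (gamma_inv_gt0 y0))//.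
    have -> : G (V (gamma^-1 * y)) = g y by rewrite /g WE// ltW// gamma_inv_gt0.
    rewrite -/(q y).
    have -> : k ^+ 2 = 2 * zeta by rewrite [in RHS]kz; field.
    by move: (V^`(2)%classic y) (V y) (q y) (g y) => a b c d e; lra.
  - move=> y y0; rewrite (le_trans (ler_normB _ _))//.
    have b1 : `|V y| <= 1 by rewrite ler_norml Vb// ltW.
    have b2 := q1 y (ltW y0).
    by rewrite (le_trans (lerD b1 b2)).
  - have E : V 0 - q 0 = 0 by rewrite V0 -qE// godd subrr.
    by rewrite -[X in _ --> X]E; exact: cvgB.
move=> x x0; apply: le_Uinf => t t0; rewrite -(WE x (ltW x0)).
apply: u_le_of_resolvent => //; last exact: ltW.
move=> y y0; rewrite WE// qE//; move: y0; rewrite le_eqVlt => /predU1P[<-|y0].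
  by rewrite V0 -qE// godd.
by have /eqP := Vq y y0; rewrite subr_eq0 => /eqP.
Unshelve. all: by end_near. Qed.

End mild.

(** * Extension of the vote function to the whole line *)

Section clamp.
Variable R : realType.

(** The projection onto [[-1, 1]] is odd, nondecreasing and 1-Lipschitz, so composing with it
    preserves these features of the vote function, whose own values outside [[-1, 1]] carry no
    meaning. *)
Definition clamp (v : R) : R := Num.max (-1) (Num.min 1 v).

Lemma clamp_bnd v : -1 <= clamp v <= 1.
Proof. by rewrite /clamp le_max lexx/= ge_max ge_min lexx /= andbT; lra. Qed.

Lemma clamp_id v : -1 <= v <= 1 -> clamp v = v.
Proof. by move=> /andP[v1 v2]; rewrite /clamp min_r// max_r. Qed.

Lemma clampN v : clamp (- v) = - clamp v.
Proof.
by rewrite /clamp oppr_max oppr_min opprK /Num.max /Num.min; do !case: ifPn; lra.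
Qed.

Lemma clamp_homo : {homo clamp : v w / v <= w}.
Proof. by move=> v w vw; rewrite /clamp /Num.max /Num.min; do !case: ifPn; lra. Qed.

Lemma clamp_lip v w : `|clamp v - clamp w| <= `|v - w|.
Proof.
wlog vw : v w / v <= w.
  move=> H; have [vw|/ltW wv] := leP v w; first exact: H.
  by rewrite distrC (distrC v); exact: H.
rewrite ler0_norm ?subr_le0 ?clamp_homo// ler0_norm ?subr_le0//.
by rewrite /clamp /Num.max /Num.min; do !case: ifPn; lra.
Qed.

End clamp.

Theorem theorem1p3 (R : realType) (gamma zeta : R)
    (p : nat -> R) (eta : nat -> nat -> R) (u : R -> R -> R)
    (gamma_gt1 : 1 < gamma) (zeta_gt0 : 0 < zeta)
    (p_law : offspring_law p) (eta_law : threshold_law eta)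
    (F_C2 : C2_on `[0, 1] (voteF p eta))
    (u_sol : mild_solution gamma zeta (voteF p eta) u)
    (F_odd : odd_on_unit (voteF p eta)) :
  exists Uinf : R -> R,
    (forall x, u t x @[t --> +oo] --> Uinf x) /\
    maximal_elliptic_solution gamma zeta (voteF p eta)
      (fun x => if 0 < x then Uinf x else 0).
Proof.
have [L L0 FL01] := C2_lipschitz F_C2.
have FL := odd_lipschitz F_odd FL01.
have N1 : -1 <= (1 : R) <= 1 by apply/andP; split; lra.
pose G v := voteF p eta (clamp v).
have FG v : -1 <= v <= 1 -> voteF p eta v = G v by move=> v1; rewrite /G clamp_id.
have G_homo : {homo G : v w / v <= w}.
  move=> v w vw; have /andP[v1 _] := clamp_bnd v; have /andP[_ w1] := clamp_bnd w.
  by apply: (voteF_homo p_law eta_law) => //; exact: clamp_homo.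
have G_odd v : G (- v) = - G v by rewrite /G clampN F_odd ?clamp_bnd.
have G_le1 v : `|G v| <= 1.
  have /andP[v1 v2] := clamp_bnd v.
  have h1 := voteF_homo p_law eta_law v1 v2 (lexx 1).
  (* The lower bound uses [F (-1) = - F 1 = - 1], which follows from oddness. *)
  have h2 := voteF_homo p_law eta_law (lexx (-1)) v1 v2.
  by rewrite ler_norml -(voteF1 p_law eta_law) -F_odd// h1 h2.
have G_lip v w : `|G v - G w| <= L * `|v - w|.
  by rewrite (le_trans (FL _ _ (clamp_bnd v) (clamp_bnd w)))// ler_wpM2l// clamp_lip.
exists (Uinf u); split.
  exact: (u_cvg zeta_gt0 gamma_gt1 L0 G_homo G_odd G_le1 G_lip FG u_sol).
split.
  exact: (Uinf_elliptic zeta_gt0 gamma_gt1 L0 G_homo G_odd G_le1 G_lip FG u_sol).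
move=> V V_sol x x0; rewrite x0.
exact: (elliptic_le_Uinf zeta_gt0 gamma_gt1 L0 G_homo G_odd G_le1 G_lip FG u_sol V_sol).
Qed.
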